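(* Let $k$ be a field. The linear map $\Omega:NQSh(\mathbb N^* )\to\mathbf{QSh}^d_+$ defined on the basis of decorated Schröder trees by $$\Omega(t)=\sum_{w:\ \varrho(w)=t}w,$$ where $w$ runs over the packed words decorated by $\mathbb N^*$ with $\varrho(w)=t$, is an injective morphism of NQSh algebras. Consequently, the NQSh subalgebra $\mathbf{QDesc}$ of $\mathbf{QSh}^d_+$ generated by the elements $\binom{1}{d}$, $d\ge1$ (the decorated packed words of length $1$), is free and isomorphic to the free NQSh algebra $NQSh(\mathbb N^* )$.
   Context: NQSh algebra: a nonunital associative algebra $(A,\bullet)$ with two further bilinear products $\prec,\succ$ such that, with $\star:=\prec+\succ+\bullet$: $(x\prec y)\prec z=x\prec(y\star z)$; $(x\succ y)\prec z=x\succ(y\prec z)$; $(x\star y)\succ z=x\succ(y\succ z)$; $(x\prec y)\bullet z=x\bullet(y\succ z)$; $(x\succ y)\bullet z=x\succ(y\bullet z)$; $(x\bullet y)\prec z=x\bullet(y\prec z)$. Trees: a decorated Schröder tree of degree $n\ge1$ is a planar rooted tree with $n+1$ leaves in which every internal vertex has at least two children, and whose $n$ spaces between consecutive leaves are decorated by elements of $\mathbb N^*$; the tree $|$ reduced to one leaf is the one of degree $0$. For trees $t_1,\dots,t_m$ ($m\ge2$, possibly equal to $|$) and $d_1,\dots,d_{m-1}\in\mathbb N^*$, $t_1\vee_{d_1}\cdots\vee_{d_{m-1}}t_m$ is obtained by grafting $t_1,\dots,t_m$ (from left to right) on a common root, the space between the last leaf of $t_i$ and the first leaf of $t_{i+1}$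 being decorated by $d_i$. The free NQSh algebra $NQSh(\mathbb N^* )$ on the set $\mathbb N^*$ has basis the decorated Schröder trees of degree $\ge1$, $d\in\mathbb N^*$ corresponding to $|\vee_d|$, with products, for $t=t_1\vee_{d_1}\cdots\vee_{d_{m-1}}t_m$ and $t'=t'_1\vee_{d'_1}\cdots\vee_{d'_{l-1}}t'_l$: $t\succ t'=(t\star t'_1)\vee_{d'_1}t'_2\vee_{d'_2}\cdots\vee_{d'_{l-1}}t'_l$, $\ t\prec t'=t_1\vee_{d_1}\cdots\vee_{d_{m-2}}t_{m-1}\vee_{d_{m-1}}(t_m\star t')$, $\ t\bullet t'=t_1\vee_{d_1}\cdots\vee_{d_{m-1}}(t_m\star t'_1)\vee_{d'_1}\cdots\vee_{d'_{l-1}}t'_l$, extended multilinearly, where $|$ is the unit of $\star$. Words: a packed word of length $n$ is a word of positive integers whose set of letters is $\{1,\dots,m\}$ for some $m$; $Pack(u)$ is the packed word with the same relative order (and equalities) of letters as $u$. A decorated packed word is a pair $(\sigma,d)$, $\sigma$ packed of length $n$, $d:\{1,\dots,n\}\to\mathbb N^*$. $\mathbf{QSh}^d_+$ has basis the nonempty decorated packed words; for $(\sigma,d)$ of length $p$ and $(\tau,e)$ of length $l$, $(\sigma,d)\prec(\tau,e)$ (resp. $\succ$, $\bullet$) is the sum of all $(u,de)$, with $de$ the concatenation of $d$ and $e$ and $u$ packed of length $p+l$ with $Pack(u(1)\cdots u(p))=\sigma$, $Pack(u(p+1)\cdots u(p+l))=\tau$ and $\min(u(1),\dots,u(p))<\min(u(p+1),\dots,u(p+l))$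 (resp. $>$, $=$). This is an NQSh algebra. Map $\varrho$ from decorated packed words to decorated Schröder trees: $\varrho(\text{empty word})=|$; if $w=(\sigma,d)$ has length $n\ge1$ and $\sigma^{-1}(1)=\{i_1<\cdots<i_q\}$, let $w_1,\dots,w_{q+1}$ be the decorated packed words obtained by packing (and keeping decorations) the factors of $w$ at positions $1..i_1-1$, $i_1+1..i_2-1$, $\dots$, $i_q+1..n$; then $\varrho(w)=\varrho(w_1)\vee_{d(i_1)}\cdots\vee_{d(i_q)}\varrho(w_{q+1})$. *)

(* Defs.v *)
From HB Require Import structures.
From mathcomp Require Import all_boot all_order all_algebra.
From mathcomp Require Import boolp classical_sets functions cardinality fsbigop.
From mathcomp.multinomials Require Import freeg.

Set Implicit Arguments.
Unset Strict Implicit.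
Unset Printing Implicit Defensive.

Import GRing.Theory.
Local Open Scope classical_set_scope.
Local Open Scope ring_scope.

(* A k-vector space with three products; the bilinearity and the axioms of NQSh
   algebras are the predicate [is_NQSh]. *)
Record nqshData (k : fieldType) := NQShData {
  nqsh_carrier :> lmodType k;
  nprec : nqsh_carrier -> nqsh_carrier -> nqsh_carrier;
  nsucc : nqsh_carrier -> nqsh_carrier -> nqsh_carrier;
  nbul : nqsh_carrier -> nqsh_carrier -> nqsh_carrier
}.

Declare Scope nqsh_scope.
Delimit Scope nqsh_scope with nqsh.
Notation "x ≺ y" := (nprec x y) (at level 40, left associativity) : nqsh_scope.
Notation "x ≻ y" := (nsucc x y) (at level 40, left associativity) : nqsh_scope.
Notation "x • y" := (nbul x y) (at level 40, left associativity) : nqsh_scope.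

Definition nstar (k : fieldType) (A : nqshData k) (x y : A) : A :=
  nprec x y + nsucc x y + nbul x y.
Notation "x ⋆ y" := (nstar x y) (at level 40, left associativity) : nqsh_scope.

Definition is_bilinear (k : fieldType) (V : lmodType k) (op : V -> V -> V) : Prop :=
  (forall x, linear (op x)) /\ (forall y, linear (op^~ y)).

Record is_NQSh (k : fieldType) (A : nqshData k) : Prop := IsNQSh {
  nprec_bilinear : is_bilinear (@nprec k A);
  nsucc_bilinear : is_bilinear (@nsucc k A);
  nbul_bilinear : is_bilinear (@nbul k A);
  nbulA : associative (@nbul k A);
  nprecA : forall x y z : A, ((x ≺ y) ≺ z = x ≺ (y ⋆ z))%nqsh;
  nsucc_prec : forall x y z : A, ((x ≻ y) ≺ z = x ≻ (y ≺ z))%nqsh;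
  nsuccA : forall x y z : A, ((x ⋆ y) ≻ z = x ≻ (y ≻ z))%nqsh;
  nprec_bul : forall x y z : A, ((x ≺ y) • z = x • (y ≻ z))%nqsh;
  nsucc_bul : forall x y z : A, ((x ≻ y) • z = x ≻ (y • z))%nqsh;
  nbul_prec : forall x y z : A, ((x • y) ≺ z = x • (y ≺ z))%nqsh
}.

Record nqsh_morphism (k : fieldType) (A B : nqshData k) (f : A -> B) : Prop :=
  NQShMorphism {
  nmor_linear : linear f;
  nmor_prec : {morph f : x y / (x ≺ y)%nqsh};
  nmor_succ : {morph f : x y / (x ≻ y)%nqsh};
  nmor_bul : {morph f : x y / (x • y)%nqsh}
}.

Definition nqsh_isomorphic (k : fieldType) (A B : nqshData k) : Prop :=
  exists f : A -> B, nqsh_morphism f /\ bijective f.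

Definition free_NQSh_on (k : fieldType) (A : nqshData k) (X : Type) (i : X -> A) :
    Prop :=
  is_NQSh A /\
  forall B : nqshData k, is_NQSh B -> forall f : X -> B,
    exists! phi : A -> B, nqsh_morphism phi /\ phi \o i = f.

Record nqsh_closed (k : fieldType) (A : nqshData k) (P : set A) : Prop :=
  NQShClosed {
  nclosed0 : P 0;
  nclosed_lin : forall (a : k) (x y : A), P x -> P y -> P (a *: x + y);
  nclosed_prec : forall x y : A, P x -> P y -> P (x ≺ y)%nqsh;
  nclosed_succ : forall x y : A, P x -> P y -> P (x ≻ y)%nqsh;
  nclosed_bul : forall x y : A, P x -> P y -> P (x • y)%nqsh
}.

Section Generated.
Variables (k : fieldType) (A : nqshData k) (S : set A).

Lemma smallest_nqsh_closed : nqsh_closed (smallest (@nqsh_closed k A) S).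
Proof.
split.
- by move=> P [PA _]; apply: nclosed0.
- by move=> a x y hx hy P hP; apply: (nclosed_lin hP.1 a); [apply: hx|apply: hy].
- by move=> x y hx hy P hP; apply: (nclosed_prec hP.1); [apply: hx|apply: hy].
- by move=> x y hx hy P hP; apply: (nclosed_succ hP.1); [apply: hx|apply: hy].
- by move=> x y hx hy P hP; apply: (nclosed_bul hP.1); [apply: hx|apply: hy].
Qed.

Definition in_generated : {pred A} := fun x => `[< smallest (@nqsh_closed k A) S x >].

Lemma in_generated_submod : submod_closed in_generated.
Proof.
split; first by apply/asboolP; apply: nclosed0 smallest_nqsh_closed.
move=> a x y /asboolP hx /asboolP hy; apply/asboolP.
exact: nclosed_lin smallest_nqsh_closed a x y hx hy.
Qed.

HB.instance Definition _ := GRing.isSubmodClosed.Build k A in_generated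
  in_generated_submod.

Record generated : Type := Generated {
  generated_val : A;
  generatedP : generated_val \in in_generated
}.

HB.instance Definition _ := [isSub for generated_val].
HB.instance Definition _ := [Choice of generated by <:].
HB.instance Definition _ := [SubChoice_isSubLmodule of generated by <:].

Lemma generated_stable (op : A -> A -> A) (x y : generated) :
  (forall u v, smallest (@nqsh_closed k A) S u -> smallest (@nqsh_closed k A) S v ->
     smallest (@nqsh_closed k A) S (op u v)) ->
  op (val x) (val y) \in in_generated.
Proof.
move=> h; apply/asboolP; apply: h; apply/asboolP; exact: generatedP.
Qed.

Definition generated_prec (x y : generated) : generated :=
  Generated (generated_stable x y (nclosed_prec smallest_nqsh_closed)).
Definition generated_succ (x y : generated) : generated :=
  Generated (generated_stable x y (nclosed_succ smallest_nqsh_closed)).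
Definition generated_bul (x y : generated) : generated :=
  Generated (generated_stable x y (nclosed_bul smallest_nqsh_closed)).

Definition generatedNQSh : nqshData k :=
  NQShData generated_prec generated_succ generated_bul.

Lemma mem_generated (x : A) : S x -> x \in in_generated.
Proof. by move=> Sx; apply/asboolP => P [_]; apply. Qed.

Definition generator (x : A) (Sx : S x) : generatedNQSh :=
  Generated (mem_generated Sx).

End Generated.

Section BilinearExtension.
Variables (k : fieldType) (I : choiceType).

Definition bilinear_ext (V : lmodType k) (f : I -> I -> V) (x y : {freeg I / k}) : V :=
  fglift (fun i => fglift (f i) y) x.

End BilinearExtension.

Definition posnat := {n : nat | (0 < n)%N}.

(* [stree] is the type of trees of degree >= 1; trees of arbitrary degree are
   [option stree], with [None] the tree | reduced to one leaf.
   [Graft t1 d1 [:: (t2, d2); ...; (t_(m-1), d_(m-1))] tm] is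
   t1 \/_d1 t2 \/_d2 ... t_(m-1) \/_d_(m-1) tm, so that m >= 2 holds by typing. *)
Inductive stree : Type :=
  Graft of option stree & posnat & seq (option stree * posnat) & option stree.

Notation tree := (option stree).

HB.instance Definition _ := gen_eqMixin stree.
HB.instance Definition _ := gen_choiceMixin stree.

Definition corolla (d : posnat) : stree := Graft None d [::] None.

(* Extension to trees of arbitrary degree, with | as unit, of a product of trees of
   degree >= 1. The value of a product of two trees is a sum of trees without
   coefficients, given by the sequence of its terms. *)
Definition unital (f : stree -> stree -> seq stree) (t t' : tree) : seq tree :=
  match t, t' with
  | None, _ => [:: t']
  | _, None => [:: t]
  | Some u, Some u' => [seq Some v | v <- f u u']
  end.

Fixpoint star_trees (t : stree) : stree -> seq stree :=
  fix star_t (t' : stree) : seq stree :=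
  let: Graft t1 d1 s tm := t in
  let: Graft t1' d1' s' tl' := t' in
  [seq Graft t1 d1 s u | u <- unital star_trees tm (Some t')]
  ++ [seq Graft u d1' s' tl' | u <- unital (fun=> star_t) (Some t) t1']
  ++ [seq Graft t1 d1 (s ++ (u, d1') :: s') tl' | u <- unital star_trees tm t1'].

Definition prec_trees (t t' : stree) : seq stree :=
  let: Graft t1 d1 s tm := t in
  [seq Graft t1 d1 s u | u <- unital star_trees tm (Some t')].

Definition succ_trees (t t' : stree) : seq stree :=
  let: Graft t1' d1' s' tl' := t' in
  [seq Graft u d1' s' tl' | u <- unital star_trees (Some t) t1'].

Definition bul_trees (t t' : stree) : seq stree :=
  let: Graft t1 d1 s tm := t in
  let: Graft t1' d1' s' tl' := t' in
  [seq Graft t1 d1 (s ++ (u, d1') :: s') tl' | u <- unital star_trees tm t1'].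

Lemma star_treesE (t t' : stree) :
  star_trees t t' = prec_trees t t' ++ succ_trees t t' ++ bul_trees t t'.
Proof. by case: t => t1 d1 s tm; case: t' => [[t1'|]] d1' s' tl'. Qed.

Section TreeAlgebra.
Variable k : fieldType.

Definition tree_op (f : stree -> stree -> seq stree) :
    {freeg stree / k} -> {freeg stree / k} -> {freeg stree / k} :=
  bilinear_ext (fun t t' => \sum_(u <- f t t') << u >>).

Definition treeNQSh : nqshData k :=
  @NQShData k {freeg stree / k}
    (tree_op prec_trees) (tree_op succ_trees) (tree_op bul_trees).

Definition tree_gen (d : posnat) : treeNQSh := << corolla d >>.

End TreeAlgebra.

(* The set of letters of [u] is {1, ..., m}, m being the number of distinct letters. *)
Definition packed (u : seq nat) : bool :=
  perm_eq (undup u) (iota 1 (size (undup u))).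

Lemma packedP (u : seq nat) : reflect (exists m, u =i iota 1 m) (packed u).
Proof.
apply: (iffP idP) => [pu|[m um]].
  by exists (size (undup u)) => x; rewrite -(perm_mem pu) mem_undup.
have uu : undup u =i iota 1 m by move=> x; rewrite mem_undup.
have pm : perm_eq (undup u) (iota 1 m).
  by apply: uniq_perm; rewrite ?undup_uniq ?iota_uniq.
by rewrite /packed (perm_size pm) size_iota.
Qed.

Definition pack (u : seq nat) : seq nat :=
  [seq (index x (sort leq (undup u))).+1 | x <- u].

Lemma size_pack (u : seq nat) : size (pack u) = size u.
Proof. exact: size_map. Qed.

Lemma pack_packed (u : seq nat) : packed (pack u).
Proof.
apply/packedP; exists (size (undup u)) => y.
have us : uniq (sort leq (undup u)) by rewrite sort_uniq undup_uniq.
apply/mapP/idP => [[x xu ->]|].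
  by rewrite mem_iota /= add1n ltnS -(size_sort leq) index_mem mem_sort mem_undup.
rewrite mem_iota add1n ltnS => /andP[y0 yn].
case: y y0 yn => // y _ yn.
exists (nth 0%N (sort leq (undup u)) y).
  by rewrite -mem_undup -(mem_sort leq) mem_nth ?size_sort.
by rewrite index_uniq ?size_sort.
Qed.

Lemma nth_pack_leq (u : seq nat) (i j : nat) : (i < size u)%N -> (j < size u)%N ->
  (nth 0%N (pack u) i <= nth 0%N (pack u) j)%N = (nth 0%N u i <= nth 0%N u j)%N.
Proof.
move=> iu ju; rewrite !(nth_map 0%N) // ltnS.
set s := sort leq (undup u).
have us : uniq s by rewrite sort_uniq undup_uniq.
have ss : sorted ltn s by rewrite ltn_sorted_uniq_leq us sort_sorted //; exact: leq_total.
have ins a : (a < size u)%N -> nth 0%N u a \in s.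
  by move=> au; rewrite mem_sort mem_undup mem_nth.
have := ins _ iu; have := ins _ ju; move: (nth 0%N u i) (nth 0%N u j) => x y ys xs.
rewrite leqNgt [RHS]leqNgt; congr (~~ _).
rewrite -{2}(nth_index 0%N xs) -{2}(nth_index 0%N ys).
have := (sorted_ltn_nth ltn_trans 0%N ss).
have xi : (index x s < size s)%N by rewrite index_mem.
have yi : (index y s < size s)%N by rewrite index_mem.
move=> h; apply/idP/idP => [/(h _ _ yi xi)//|lt_yx].
rewrite ltnNge; apply/negP; rewrite leq_eqVlt => /orP[/eqP e|/(h _ _ xi yi) /= lt_xy].
  by move: lt_yx; rewrite e ltnn.
by move: (ltn_trans lt_yx lt_xy); rewrite ltnn.
Qed.

(* A decorated word is the sequence of its pairs (letter, decoration). *)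
Notation dword := (seq (nat * posnat)).
Definition letters (w : dword) : seq nat := unzip1 w.
Definition decos (w : dword) : seq posnat := unzip2 w.
Definition dpack (w : dword) : dword := zip (pack (letters w)) (decos w).

Record dpword : Type := DPWord {
  dpword_val :> seq (nat * posnat);
  _ : packed (letters dpword_val) && (dpword_val != [::])
}.
HB.instance Definition _ := [isSub for dpword_val].
HB.instance Definition _ := [Choice of dpword by <:].

Definition min_letter (u : seq nat) : nat := foldr minn (head 0%N u) u.

Lemma min_letterP (u : seq nat) : u != [::] ->
  min_letter u \in u /\ forall x, x \in u -> (min_letter u <= x)%N.
Proof.
rewrite /min_letter; case: u => // a u _ /=; split.
  have : foldr minn a u \in a :: u.
    elim: u => [|b u IH] /=; first by rewrite inE.
    case: (leqP b (foldr minn a u)) => _; first by rewrite in_cons mem_head orbT.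
    by move: IH; rewrite !in_cons => /orP[->|->]; rewrite ?orbT.
  by case: (leqP a (foldr minn a u)) => // _; rewrite mem_head.
move=> x; rewrite inE geq_min => /predU1P[->|]; first by rewrite leqnn.
move=> xu; apply/orP; right; elim: u xu => // b u IH.
by rewrite inE geq_min => /predU1P[->|/IH ->]; rewrite ?leqnn ?orbT.
Qed.

(* [cmp] compares the minimum of the first part with that of the second part. *)
Definition shuffles (cmp : rel nat) (v w : dpword) : set dpword :=
  [set x : dpword |
    [/\ decos x = decos v ++ decos w,
        pack (take (size v) (letters x)) = letters v,
        pack (drop (size v) (letters x)) = letters w &
        cmp (min_letter (take (size v) (letters x)))
            (min_letter (drop (size v) (letters x)))]].

Section WordAlgebra.
Variable k : fieldType.

Definition word_op (cmp : rel nat) :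
    {freeg dpword / k} -> {freeg dpword / k} -> {freeg dpword / k} :=
  bilinear_ext (fun v w => \sum_(x \in shuffles cmp v w)
                            (<< x >> : {freeg dpword / k})).

Definition QShd : nqshData k :=
  @NQShData k {freeg dpword / k}
    (word_op ltn) (word_op gtn) (word_op eq_op).

Definition letter_word (d : posnat) : dpword :=
  @DPWord [:: (1%N, d)] (erefl true).

Definition word_gen (d : posnat) : QShd := << letter_word d >>.

Definition QDesc : nqshData k := generatedNQSh (range word_gen).

Definition QDesc_gen (d : posnat) : QDesc := generator (imageT word_gen d).

End WordAlgebra.

(* Cuts w = w_1 (1,d_1) w_2 (1,d_2) ... w_q (1,d_q) w_(q+1), with no letter 1 in the
   w_i, into [:: (w_1, d_1); ...; (w_q, d_q)] and w_(q+1). *)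
Fixpoint cut1 (w : dword) : seq (dword * posnat) * dword :=
  match w with
  | [::] => ([::], [::])
  | (a, d) :: w' =>
    let: (s, l) := cut1 w' in
    if a == 1%N then (([::], d) :: s, l)
    else match s with
         | [::] => ([::], (a, d) :: l)
         | (v, e) :: s' => (((a, d) :: v, e) :: s', l)
         end
  end.

Lemma cut1K (w : dword) :
  w = flatten [seq rcons p.1 (1%N, p.2) | p <- (cut1 w).1] ++ (cut1 w).2.
Proof.
elim: w => //= -[a d] w; case: (cut1 w) => -[|[v e] s] l /= IH;
  by case: (eqVneq a 1%N) => [->|_] /=; rewrite IH.
Qed.

Lemma cut1_neq1 (w : dword) :
  all (fun p => 1%N \notin letters p.1) (cut1 w).1 /\ 1%N \notin letters (cut1 w).2.
Proof.
elim: w => //= -[a d] w; case: (cut1 w) => -[|[v e] s] l /= [IH1 IH2];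
  case: (eqVneq a 1%N) => [a1|a1] /=; split=> //=;
  by rewrite inE negb_or eq_sym a1.
Qed.

(* Recursion on a bound [n] of the length of the word; see [rhoE]. *)
Fixpoint rho_rec (n : nat) (w : dword) : tree :=
  match n, cut1 w with
  | n'.+1, ((w1, d1) :: s, l) =>
    Some (Graft (rho_rec n' (dpack w1)) d1
                [seq (rho_rec n' (dpack p.1), p.2) | p <- s]
                (rho_rec n' (dpack l)))
  | _, _ => None
  end.

Definition rho (w : dword) : tree := rho_rec (size w) w.

Lemma rho_nil : rho [::] = None. Proof. by []. Qed.

Lemma size_dpack (w : dword) : size (dpack w) = size w.
Proof. by rewrite size_zip size_pack !size_map minnn. Qed.

Lemma size_cut1 (w : dword) :
  all (fun p => (size p.1 < size w)%N) (cut1 w).1 /\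
  (size (cut1 w).2 + size (cut1 w).1 <= size w)%N.
Proof.
elim: w => //= -[a d] w; case: (cut1 w) => -[|[v e] s] l /= [IH1 IH2].
  by case: eqVneq => _ /=; split=> //; move: IH2; rewrite ?addn0 ?addn1.
move/andP: IH1 => [h1 h2].
have h2' : all (fun p : dword * posnat => (size p.1 < (size w).+1)%N) s.
  by apply: sub_all h2 => p /ltnW.
case: eqVneq => _ /=; rewrite ?h2' ?andbT; split=> //.
- by rewrite ltnW.
- by rewrite addnS ltnS.
- exact: leqW.
Qed.

Lemma rho_rec_stable (n m : nat) (w : dword) :
  (size w <= n)%N -> (size w <= m)%N -> rho_rec n w = rho_rec m w.
Proof.
elim: n m w => [|n IH] m w.
  by rewrite leqn0 size_eq0 => /eqP ->; case: m.
case: m => [_|m wn wm]; first by rewrite leqn0 size_eq0 => /eqP ->.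
have [] := size_cut1 w; rewrite /=.
case: (cut1 w) => -[|[w1 d1] s] l //= /andP[h1 hs] hl.
have le v : (size v < size w)%N -> rho_rec n (dpack v) = rho_rec m (dpack v).
  by move=> vw; apply: IH; rewrite size_dpack -ltnS (leq_trans vw).
have lw : (size l < size w)%N by apply: leq_trans hl; rewrite addnS ltnS leq_addr.
rewrite (le _ h1) (le _ lw); congr (Some (Graft _ _ _ _)).
by apply/eq_in_map => p ps; rewrite le // (allP hs).
Qed.

Lemma rhoE (w : dword) :
  rho w = match cut1 w with
          | ((w1, d1) :: s, l) =>
            Some (Graft (rho (dpack w1)) d1 [seq (rho (dpack p.1), p.2) | p <- s]
                        (rho (dpack l)))
          | _ => None
          end.
Proof.
rewrite {1}/rho (rho_rec_stable (leqnn _) (leqnSn _)) /=.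
have [] := size_cut1 w.
case: (cut1 w) => -[|[w1 d1] s] l //= /andP[h1 hs] hl.
have le v : (size v < size w)%N -> rho_rec (size w) (dpack v) = rho (dpack v).
  by move=> vw; apply: rho_rec_stable; rewrite ?size_dpack // ltnW.
have lw : (size l < size w)%N by apply: leq_trans hl; rewrite addnS ltnS leq_addr.
rewrite (le _ h1) (le _ lw); congr (Some (Graft _ _ _ _)).
by apply/eq_in_map => p ps; rewrite le // (allP hs).
Qed.

Definition Omega (k : fieldType) : treeNQSh k -> QShd k :=
  fglift (fun t : stree => \sum_(w \in [set w : dpword | rho w = Some t])
                             (<< w >> : {freeg dpword / k})).

(* Main.v *)
Require Import Defs.
From mathcomp Require Import all_boot all_algebra.
From mathcomp Require Import boolp classical_sets functions cardinality fsbigop.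
From mathcomp.multinomials Require Import freeg.
From mathcomp Require Import zify ring.

(* An element of QSh^d is identified with a function on all decorated words which
   depends only on the standardization; the products become convolutions over the
   deconcatenations u = ab, restricted by the comparison of min a and min b, and the
   NQSh axioms reduce to coassociativity of deconcatenation and elementary facts on
   three minima. Omega x then becomes the function u |-> (coefficient of rho(u) in x):
   it is injective because rho is onto, and it is a morphism because, for words,
   cutting u in two amounts to the transpose of the products on trees, as one sees by
   cutting u at the occurrences of its minimum. The axioms for trees follow by
   injectivity. Freeness of the tree algebra comes from the expression of a tree in
   terms of its subtrees and the generators, and the statement on QDesc from the fact
   that the range of Omega is the generated subalgebra. *)

Set Implicit Arguments.
Unset Strict Implicit.
Unset Printing Implicit Defensive.

Import GRing.Theory.

(** * Words and their trees *)

Fixpoint splits (T : Type) (u : seq T) : seq (seq T * seq T) :=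
  if u is a :: v then ([::], u) :: [seq (a :: p.1, p.2) | p <- splits v]
  else [:: ([::], [::])].

Lemma splits_cat (T : eqType) (u : seq T) (p : seq T * seq T) :
  p \in splits u -> p.1 ++ p.2 = u.
Proof.
elim: u p => [|a u IH] p /=; first by rewrite inE => /eqP ->.
by rewrite inE => /predU1P[->//|/mapP[q /IH <- ->]].
Qed.

(** A cut falls either before or after the marked letter [x]. This is the induction step for words
    cut at successive occurrences of their minimum. *)
Lemma count_splits_cat_cons (T : eqType) (P : pred (seq T * seq T)) a x b :
  count P (splits (a ++ x :: b)) =
  count (fun p => P (p.1, p.2 ++ x :: b)) (splits a) +
  count (fun p => P (a ++ x :: p.1, p.2)) (splits b).
Proof.
elim: a P => [|y a IH] P /=; first by rewrite count_map addn0.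
rewrite !count_map IH -addnA; congr (_ + (_ + _)).
Qed.

Lemma count_splits_nill (T : eqType) (P : pred (seq T)) (u : seq T) :
  count (fun p => (p.1 == [::]) && P p.2) (splits u) = P u.
Proof.
case: u => [|a u] /=; first by rewrite addn0.
by rewrite count_map (@eq_count _ _ pred0) ?count_pred0 ?addn0.
Qed.

Lemma count_splits_nilr (T : eqType) (P : pred (seq T)) (u : seq T) :
  count (fun p => P p.1 && (p.2 == [::])) (splits u) = P u.
Proof.
elim: u P => [|a u IH] P /=; first by rewrite andbT addn0.
by rewrite andbF count_map -(IH (fun v => P (a :: v))).
Qed.

(** * Standardization and increasing relabellings *)

Definition relabel (f : nat -> nat) (w : dword) : dword :=
  [seq (f p.1, p.2) | p <- w].

Lemma letters_relabel f w : letters (relabel f w) = map f (letters w).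
Proof. by rewrite /letters /unzip1 -!map_comp. Qed.

Lemma decos_relabel f w : decos (relabel f w) = decos w.
Proof. by rewrite /decos /unzip2 -map_comp. Qed.

Lemma decos_dpack w : decos (dpack w) = decos w.
Proof. by rewrite /decos unzip2_zip // size_pack !size_map. Qed.

Lemma letters_dpack w : letters (dpack w) = pack (letters w).
Proof. by rewrite /letters unzip1_zip // size_pack !size_map. Qed.

(** By construction [pack u] is [map (rank u) u], so standardization is one particular relabelling,
    increasing on the letters of [u]. *)
Definition rank (u : seq nat) (x : nat) := (index x (sort leq (undup u))).+1.

Lemma dpackE w : dpack w = relabel (rank (letters w)) w.
Proof.
rewrite /dpack -[pack _]/(map (rank (letters w)) (letters w)).
move: (rank (letters w)) => f; rewrite /letters /decos /relabel.
by elim: w => //= -[a d] w ->.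
Qed.

Definition increasing_on (f : nat -> nat) (u : seq nat) : Prop :=
  {in u &, {mono f : x y / x <= y}}.

Lemma rank_increasing (u : seq nat) : increasing_on (rank u) u.
Proof.
move=> x y xu yu.
have := nth_pack_leq (u := u) (i := index x u) (j := index y u).
by rewrite !index_mem !(nth_map 0) ?index_mem // !nth_index // => ->.
Qed.

Lemma increasing_on_inj f u : increasing_on f u -> {in u &, injective f}.
Proof.
move=> fu x y xu yu e; apply/eqP.
by rewrite eqn_leq -(fu x y) // -(fu y x) // e leqnn.
Qed.

(** An increasing map commutes with sorting and with the removal of duplicates, so each letter keeps
    its index in the sorted list of letters. *)
Lemma pack_map f u : increasing_on f u -> pack (map f u) = pack u.
Proof.
move=> fu; have fi := increasing_on_inj fu.
have su : {subset undup u <= u} by move=> x; rewrite mem_undup.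
have e : sort leq (undup (map f u)) = map f (sort leq (undup u)).
  apply: (sorted_eq leq_trans anti_leq).
  - by apply: sort_sorted; exact: leq_total.
  - have fh : {in mem u &, {homo f : x y / x <= y}} by move=> x y xu yu; rewrite fu.
    apply: (homo_sorted_in fh); last by apply: sort_sorted; exact: leq_total.
    by apply/allP => x; rewrite mem_sort mem_undup.
  - rewrite perm_sort perm_sym; apply: perm_trans (perm_map f (permEl (perm_sort _ _))) _.
    apply: uniq_perm; rewrite ?undup_uniq ?map_inj_in_uniq ?undup_uniq //.
      by move=> x y /su xu /su yu; exact: fi.
    by move=> y; rewrite mem_undup; apply/mapP/mapP => -[x xu ->]; exists x => //;
      move: xu; rewrite mem_undup.
rewrite /pack e -map_comp; apply/eq_in_map => x xu /=; congr _.+1.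
rewrite /index find_map; apply: eq_in_find => y.
rewrite mem_sort mem_undup => yu /=; apply/eqP/eqP => [/fi|->//]; exact.
Qed.

Lemma dpack_relabel f w : increasing_on f (letters w) ->
  dpack (relabel f w) = dpack w.
Proof. by move=> fw; rewrite /dpack letters_relabel decos_relabel pack_map. Qed.

Lemma dpack_id w : packed (letters w) -> dpack w = w.
Proof.
move=> /packedP[m wm].
have e : sort leq (undup (letters w)) = iota 1 m.
  apply: (sorted_eq leq_trans anti_leq).
  - by apply: sort_sorted; exact: leq_total.
  - exact: iota_sorted.
  - rewrite perm_sort; apply: uniq_perm; rewrite ?undup_uniq ?iota_uniq // => x.
    by rewrite mem_undup wm.
rewrite dpackE; apply: map_id_in => -[a d] aw /=; congr pair.
have : a \in letters w by apply/mapP; exists (a, d).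
rewrite wm /rank e mem_iota => /andP[a1 am].
(* The letter [a] has index [a.-1] in 1, ..., m, and the successor in [rank] restores [a]. *)
have {1}-> : a = nth 0 (iota 1 m) a.-1 by rewrite nth_iota; lia.
by rewrite index_uniq ?iota_uniq ?size_iota; lia.
Qed.

Lemma packed_dpack w : packed (letters (dpack w)).
Proof. by rewrite letters_dpack pack_packed. Qed.

Lemma min_letter_unique u m : m \in u -> (forall x, x \in u -> m <= x) ->
  min_letter u = m.
Proof.
move=> mu um; have u0 : u != [::] by case: u mu um.
have [h1 h2] := min_letterP u0.
by apply/eqP; rewrite eqn_leq h2 // um.
Qed.

Lemma min_letter_cat u v : u != [::] -> v != [::] ->
  min_letter (u ++ v) = minn (min_letter u) (min_letter v).
Proof.
move=> /min_letterP[u1 u2] /min_letterP[v1 v2].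
apply: min_letter_unique => [|x]; rewrite mem_cat ?geq_min.
  by case: leqP => _; rewrite ?u1 ?v1 ?orbT.
by case/orP => [/u2 ->//|/v2 ->]; rewrite orbT.
Qed.

Lemma min_letter_map f u : u != [::] -> increasing_on f u ->
  min_letter (map f u) = f (min_letter u).
Proof.
move=> /min_letterP[u1 u2] fu; apply: min_letter_unique; first exact: map_f.
by move=> _ /mapP[x xu ->]; rewrite fu ?u2.
Qed.

(* Words are not required to be packed here, so that factors need no repacking and
   words with the same standardization get the same tree. *)
Definition wtree (w : dword) : tree := rho (dpack w).

Lemma wtree_nil : wtree [::] = None. Proof. by []. Qed.

Lemma wtree_relabel f w : increasing_on f (letters w) ->
  wtree (relabel f w) = wtree w.
Proof. by move=> fw; rewrite /wtree dpack_relabel. Qed.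

(* The pair ([:: (t_1, d_1); ...; (t_(m-1), d_(m-1))], t_m) stands for
   t_1 \/_d1 ... \/_d(m-1) t_m, and for t_m alone when m = 1. *)
Definition flat : Type := (seq (tree * posnat) * tree)%type.

Definition graft (A : flat) : tree :=
  if A.1 is (t, d) :: s then Some (Graft t d s A.2) else A.2.

Definition flatten_tree (t : stree) : flat :=
  let: Graft t1 d1 s l := t in ((t1, d1) :: s, l).

(** Nonempty lists are required because [graft] sends [([::], t)] to [t], which may itself be the
    grafting of another pair. *)
Lemma graft_inj A B : A.1 != [::] -> B.1 != [::] -> graft A = graft B -> A = B.
Proof. by case: A B => [[|[? ?] ?] ?] [[|[? ?] ?] ?] //= _ _ [-> -> -> ->]. Qed.

Lemma graftK t A : A.1 != [::] -> graft A = Some t -> A = flatten_tree t.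
Proof. by case: A => [[|[? ?] ?] ?] //= _ [<-]. Qed.

Lemma flatten_treeK t : graft (flatten_tree t) = Some t.
Proof. by case: t. Qed.

(** The marking letter is a parameter because the minimum of a word that is not packed can be any
    integer. *)
Fixpoint cut (m : nat) (w : dword) : seq (dword * posnat) * dword :=
  match w with
  | [::] => ([::], [::])
  | (a, d) :: w' =>
    let: (s, l) := cut m w' in
    if a == m then (([::], d) :: s, l)
    else match s with
         | [::] => ([::], (a, d) :: l)
         | (v, e) :: s' => (((a, d) :: v, e) :: s', l)
         end
  end.

Lemma cut_notin m w : m \notin letters w -> cut m w = ([::], w).
Proof.
elim: w => //= -[a d] w IH; rewrite inE negb_or eq_sym => /andP[/negbTE am /IH ->].
by rewrite am.
Qed.

Lemma cut_cat_cons m a d b : m \notin letters a ->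
  cut m (a ++ (m, d) :: b) = ((a, d) :: (cut m b).1, (cut m b).2).
Proof.
elim: a => [|[x e] a IH] /=; first by case: (cut m b) => s l /= _; rewrite eqxx.
by rewrite inE negb_or eq_sym => /andP[/negbTE xm /IH ->]; rewrite xm.
Qed.

(** Induction on the occurrences of [m]: a word containing [m] is split at the first one, and only
    the part after it is again treated by induction. *)
Lemma wordP (m : nat) (P : dword -> Prop) :
  (forall w, m \notin letters w -> P w) ->
  (forall a d b, m \notin letters a -> P b -> P (a ++ (m, d) :: b)) ->
  forall w, P w.
Proof.
move=> P0 P1 w; have [n] := ubnP (size w); elim: n w => // n IH w wn.
have [mw|/P0//] := boolP (m \in letters w).
have : exists a d b, m \notin letters a /\ w = a ++ (m, d) :: b.
  elim: w mw {wn} => //= -[x e] w IHw; rewrite inE.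
  have [->|xm /= /IHw[a [d [b [ma ->]]]]] := eqVneq m x; first by exists [::], e, w.
  by exists ((x, e) :: a), d, b; split; rewrite //= inE negb_or xm.
move=> [a [d [b [ma e]]]]; rewrite e; apply: P1 => //; apply: IH.
by move: wn; rewrite e size_cat /=; lia.
Qed.

(* When m is smaller than all letters of w, the first component is empty, so that w
   is seen as a single factor. *)
Definition flat_word (m : nat) (w : dword) : flat :=
  ([seq (wtree p.1, p.2) | p <- (cut m w).1], wtree (cut m w).2).

Lemma flat_word_notin m w : m \notin letters w -> flat_word m w = ([::], wtree w).
Proof. by move=> mw; rewrite /flat_word cut_notin. Qed.

Lemma flat_word_cat_cons m a d b : m \notin letters a ->
  flat_word m (a ++ (m, d) :: b) =
  ((wtree a, d) :: (flat_word m b).1, (flat_word m b).2).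
Proof. by move=> ma; rewrite /flat_word cut_cat_cons. Qed.

Lemma flat_word_nilP m w : ((flat_word m w).1 == [::]) = (m \notin letters w).
Proof.
elim/(@wordP m): w => [w mw|a d b ma IH]; first by rewrite flat_word_notin // mw.
by rewrite flat_word_cat_cons //= /letters /unzip1 map_cat mem_cat /= inE eqxx orbT.
Qed.

Lemma cut1E w : cut1 w = cut 1 w.
Proof. by elim: w => //= -[a d] w ->. Qed.

Lemma cut_relabel m m' f w : {in letters w, forall x, (f x == m') = (x == m)} ->
  cut m' (relabel f w) =
  ([seq (relabel f p.1, p.2) | p <- (cut m w).1], relabel f (cut m w).2).
Proof.
elim: w => //= -[a d] w IH fw /=.
rewrite IH => [|x xw]; last by apply: fw; rewrite inE xw orbT.
rewrite fw ?inE ?eqxx //; case: (cut m w) => -[|[v e] s] l /=; by case: eqP.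
Qed.

Lemma cut_sub m w : {in (cut m w).1, forall p, {subset letters p.1 <= letters w}}
  /\ {subset letters (cut m w).2 <= letters w}.
Proof.
elim/(@wordP m): w => [w mw|a d b ma [IH1 IH2]]; first by rewrite cut_notin //; split=> [p|x].
have sub x : x \in letters b -> x \in letters (a ++ (m, d) :: b).
  by move=> xb; rewrite /letters /unzip1 map_cat mem_cat inE -/(letters b) xb !orbT.
rewrite cut_cat_cons //=; split=> [p|x /IH2 /sub//]; rewrite inE => /predU1P[->|].
  by move=> x xa; rewrite /letters /unzip1 map_cat mem_cat -/(letters a) xa.
by move=> pb x /(IH1 _ pb) /sub.
Qed.

(** The recursion of [rho] without repacking. If [m] occurs it is the minimum, which packing sends
    to 1, so cutting the packed word at 1 amounts to cutting [w] at [m]; packing [w] is moreover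
    increasing on each factor, hence harmless for its tree. If [m] does not occur there is a single
    factor, [w] itself. *)
Lemma wtreeE m w : {in letters w, forall x, m <= x} -> wtree w = graft (flat_word m w).
Proof.
move=> mw; have [mi|mi] := boolP (m \in letters w); last by rewrite flat_word_notin.
have inc := rank_increasing (u := letters w).
have f1 : {in letters w, forall x, (rank (letters w) x == 1) = (x == m)}.
  move=> x xw; have fm : rank (letters w) m = 1.
    have /packedP[v] := pack_packed (letters w).
    case: v => [|v] h.
      by have := h (rank (letters w) m); rewrite /= map_f.
    have /mapP[y yw y1] : 1 \in pack (letters w) by rewrite h mem_head.
    (* Some letter [y] has rank 1, and [m] lies below it. *)
    have : rank (letters w) m <= 1 by rewrite y1 inc ?mw.
    by rewrite /rank ltnS leqn0 => /eqP ->.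
  rewrite -fm; apply/eqP/eqP => [|-> //]; exact: increasing_on_inj inc _ _ xw mi.
rewrite /wtree rhoE dpackE cut1E (cut_relabel f1) /=.
have [s1 s2] := cut_sub m w.
have inc' v : {subset letters v <= letters w} ->
    rho (dpack (relabel (rank (letters w)) v)) = wtree v.
  move=> vw; apply: wtree_relabel => x y /vw xw /vw yw; exact: inc.
have := flat_word_nilP m w; rewrite mi /= /flat_word.
case: (cut m w) s1 s2 => -[|[w1 d1] s] l //= s1 s2 _; congr (Some (Graft _ _ _ _)).
- by rewrite inc' // => x; apply: (s1 (w1, d1)); rewrite mem_head.
- rewrite -map_comp; apply/eq_in_map => p ps /=; rewrite inc' // => x.
  by apply: (s1 p); rewrite inE ps orbT.
- by rewrite inc'.
Qed.

Lemma wtree_eq_None w : (wtree w == None) = (w == [::]).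
Proof.
have [->//|w0] := eqVneq w [::].
have l0 : letters w != [::] by case: w w0.
have [h1 h2] := min_letterP l0.
have := flat_word_nilP (min_letter (letters w)) w.
by rewrite (wtreeE h2) h1 /graft; case: (flat_word _ _) => -[|[? ?] ?] ?.
Qed.

(** * Duality between deconcatenation and the products of trees *)

(** The sequences of subtrees are joined by merging the last tree of [A] with the first tree of [B]
    through ⋆. Depending on which of the two lists are empty, this is ≺, ≻, • or ⋆ itself, so that
    one duality statement covers all the products. *)
Definition flat_prod (A B : flat) : seq flat :=
  if B.1 is (t, d) :: s
  then [seq (A.1 ++ (u, d) :: s, B.2) | u <- unital star_trees A.2 t]
  else [seq (A.1, u) | u <- unital star_trees A.2 B.2].

Lemma map_Some_prec t t' : map Some (prec_trees t t') =
  map graft (flat_prod (flatten_tree t) ([::], Some t')).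
Proof. by case: t => t1 d1 s l; rewrite /= -!map_comp. Qed.

Lemma map_Some_succ t t' : map Some (succ_trees t t') =
  map graft (flat_prod ([::], Some t) (flatten_tree t')).
Proof. by case: t' => t1 d1 s l; rewrite /= -!map_comp. Qed.

Lemma map_Some_bul t t' : map Some (bul_trees t t') =
  map graft (flat_prod (flatten_tree t) (flatten_tree t')).
Proof. by case: t => t1 d1 s l; case: t' => t1' d1' s' l'; rewrite /= -!map_comp. Qed.

Lemma flat_prod_neq_nil A B : (A.1 != [::]) || (B.1 != [::]) ->
  all (fun C : flat => C.1 != [::]) (flat_prod A B).
Proof.
case: A B => [s l] [[|[t d] s'] l'] /= h; rewrite /flat_prod all_map; apply/allP => u _ //=.
  by move: h; rewrite orbF.
by case: s h.
Qed.

Lemma count_map_graft C L : C.1 != [::] -> all (fun C : flat => C.1 != [::]) L ->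
  count_mem (graft C) (map graft L) = count_mem C L.
Proof.
move=> C0 /allP L0; rewrite count_map; apply: eq_in_count => D /L0 D0 /=.
by apply/eqP/eqP => [/graft_inj|->//]; apply.
Qed.

(* The coproduct dual to ⋆ deconcatenates words. *)
Definition star_dual (w : dword) : Prop := forall t t',
  count_mem (wtree w) (unital star_trees t t') =
  count (fun p => (wtree p.1 == t) && (wtree p.2 == t')) (splits w).

(** Induction over the occurrences of [m]. Without [m], the word is one factor and ⋆-duality is
    applied to [w] itself, hence the strict bound by [n]. If [m] occurs, the duality is applied only
    to factors, which are strictly shorter, so length [n] is allowed. *)
Lemma flat_prod_dual (m n : nat) (w : dword) :
  (forall v, size v < n -> star_dual v) ->
  size w < n + (m \in letters w) -> forall A B,
  count_mem (flat_word m w) (flat_prod A B) =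
  count (fun p => (flat_word m p.1 == A) && (flat_word m p.2 == B)) (splits w).
Proof.
move=> Sn; elim/(@wordP m): w => [w mw|a d b ma IH].
  rewrite (negbTE mw) addn0 => /Sn Sw [s l] [s' l'].
  rewrite flat_word_notin //.
  have -> : count (fun p => (flat_word m p.1 == (s, l)) && (flat_word m p.2 == (s', l')))
      (splits w) = (s == [::]) && (s' == [::]) *
      count (fun p => (wtree p.1 == l) && (wtree p.2 == l')) (splits w).
    case e : (_ && _); rewrite ?mul1n ?mul0n.
      apply: eq_in_count => p /splits_cat pw.
      move: mw; rewrite -pw /letters /unzip1 map_cat mem_cat negb_or => /andP[m1 m2].
      by rewrite !flat_word_notin // !xpair_eqE !(eq_sym [::]); move/andP: e => [-> ->].
    rewrite (@eq_in_count _ _ pred0) ?count_pred0 // => p /splits_cat pw.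
    move: mw; rewrite -pw /letters /unzip1 map_cat mem_cat negb_or => /andP[m1 m2].
    by rewrite !flat_word_notin // !xpair_eqE !(eq_sym [::]) /= andbACA e.
  rewrite -Sw; case: s' => [|[t e] s'] /=; rewrite /flat_prod /= count_map.
    rewrite andbT; case: eqP => [->|/eqP s0]; rewrite ?mul1n ?mul0n.
      by apply: eq_count => u /=; rewrite xpair_eqE eqxx.
    rewrite (@eq_count _ _ pred0) ?count_pred0 // => u /=.
    by rewrite xpair_eqE (negbTE s0).
  rewrite andbF mul0n (@eq_count _ _ pred0) ?count_pred0 // => u /=.
  by rewrite xpair_eqE; case: s.
rewrite size_cat /= /letters /unzip1 map_cat mem_cat /= inE eqxx orbT /= => sz A B.
have Sa : star_dual a by apply: Sn; lia.
have {}IH := IH (_ : size b < n + _).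
have {IH}IHb : forall A B, count_mem (flat_word m b) (flat_prod A B) =
  count (fun p => (flat_word m p.1 == A) && (flat_word m p.2 == B)) (splits b).
  by apply: IH; lia.
rewrite count_splits_cat_cons flat_word_cat_cons //.
set F := flat_word m b in IHb *.
have -> : count (fun p => (flat_word m (p.1, p.2 ++ (m, d) :: b).1 == A) &&
    (flat_word m (p.1, p.2 ++ (m, d) :: b).2 == B)) (splits a) =
  count (fun p => (([::], wtree p.1) == A) && (((wtree p.2, d) :: F.1, F.2) == B))
    (splits a).
  apply: eq_in_count => p /splits_cat pa /=.
  move: ma; rewrite -pa /letters /unzip1 map_cat mem_cat negb_or => /andP[m1 m2].
  by rewrite flat_word_notin // flat_word_cat_cons.
have -> : count (fun p => (flat_word m (a ++ (m, d) :: p.1, p.2).1 == A) &&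
    (flat_word m (a ++ (m, d) :: p.1, p.2).2 == B)) (splits b) =
  count (fun p => (((wtree a, d) :: (flat_word m p.1).1, (flat_word m p.1).2) == A) &&
    (flat_word m p.2 == B)) (splits b).
  by apply: eq_count => p /=; rewrite flat_word_cat_cons.
(* The shape of [A] locates the cut. With an empty list, the first part contains no [m] and the cut
   lies inside [a], where the duality for [a] applies. Otherwise the first part contains [a] and the
   first [m], which give the head of [A], and the induction hypothesis for [b] handles the rest. *)
case: A => [[|[t e] s] l].
  rewrite [X in _ + X](@eq_count _ _ pred0) ?count_pred0 ?addn0; last first.
    by move=> p; apply/negbTE/negP => /andP[/eqP].
  case: B => [[|[t' e'] s'] l']; rewrite /flat_prod /= count_map.
    rewrite !(@eq_count _ _ pred0) ?count_pred0 // => p /=;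
    by rewrite !xpair_eqE /= ?andbF.
  rewrite (@eq_count _ _ (fun u => (((d == e') && (F == (s', l')))) &&
    (u == wtree a))); last first.
    move=> u /=; rewrite [F]surjective_pairing !xpair_eqE /= eqseq_cons xpair_eqE.
    rewrite (eq_sym e') (eq_sym s') (eq_sym l').
    by case: (u == _); rewrite ?andbT ?andbF //= andbA.
  rewrite [RHS](@eq_count _ _ (fun p => (((d == e') && (F == (s', l')))) &&
     ((wtree p.1 == l) && (wtree p.2 == t')))); last first.
    move=> p /=; rewrite [F in RHS]surjective_pairing !xpair_eqE /= eqseq_cons xpair_eqE /=.
    by do 5!case: (_ == _).
  case: (_ && _); last by rewrite !count_pred0.
  by rewrite Sa.
rewrite [X in _ = X + _](@eq_count _ _ pred0) ?count_pred0; last first.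
  by move=> p; apply/negbTE/negP => /andP[/eqP].
have -> : flat_prod ((t, e) :: s, l) B =
    [seq ((t, e) :: C.1, C.2) | C : flat <- flat_prod (s, l) B].
  by case: B => [[|[t' e'] s'] l']; rewrite /flat_prod -!map_comp.
rewrite count_map (@eq_count _ _
  (fun C => ((wtree a == t) && (d == e)) && (C == F))); last first.
  move=> C /=; rewrite [F]surjective_pairing [C in RHS]surjective_pairing.
  by rewrite !xpair_eqE /= eqseq_cons xpair_eqE (eq_sym t) (eq_sym e) -!andbA.
rewrite [RHS](@eq_count _ _ (fun p => ((wtree a == t) && (d == e)) &&
   ((flat_word m p.1 == (s, l)) && (flat_word m p.2 == B)))); last first.
  move=> p /=; rewrite [flat_word m p.1 in RHS]surjective_pairing.
  by rewrite !xpair_eqE /= eqseq_cons xpair_eqE -!andbA.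
case: (_ && _); last by rewrite !count_pred0.
by rewrite -IHb.
Qed.

Definition op_dual (op : stree -> stree -> seq stree) (cmp : rel nat) (w : dword) : Prop :=
  forall t t', count_mem (wtree w) (map Some (op t t')) =
  count (fun p => [&& cmp (min_letter (letters p.1)) (min_letter (letters p.2)),
                      wtree p.1 == Some t & wtree p.2 == Some t']) (splits w).

(** With the next lemma: for a lower bound [m] of the letters, the two encodings [flatten_tree t]
    and [([::], t)] of a tree distinguish the words which attain [m] from those which do not. *)
Lemma flat_word_flatten_tree m w t : {in letters w, forall x, m <= x} ->
  (flat_word m w == flatten_tree t) = (m \in letters w) && (wtree w == Some t).
Proof.
move=> mw; rewrite -[m \in _]negbK -flat_word_nilP (wtreeE mw).
apply/eqP/andP => [->|[h /eqP]]; last by move/graftK => ->.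
by split; last exact/eqP/flatten_treeK; case: t.
Qed.

Lemma flat_word_nil_tree m w t : {in letters w, forall x, m <= x} ->
  (flat_word m w == ([::], t)) = (m \notin letters w) && (wtree w == t).
Proof.
move=> mw; rewrite -flat_word_nilP (wtreeE mw).
by case: (flat_word m w) => [[|[? ?] ?] ?].
Qed.

(** Let [m] be the minimum of [w]. In a cut into two nonempty parts, [m] lies only in the first,
    only in the second, or in both, according to whether the first minimum is smaller, larger or
    equal. These are the cases of [flat_prod_dual] yielding ≺, ≻ and •. *)
Lemma op_dual_of_star_dual (n : nat) (w : dword) :
  (forall v, size v < n -> star_dual v) -> size w <= n ->
  [/\ op_dual prec_trees ltn w, op_dual succ_trees gtn w & op_dual bul_trees eq_op w].
Proof.
move=> Sn wn.
have [->|w0] := eqVneq w [::].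
  by split=> t t'; rewrite wtree_nil; (transitivity 0;
    [by apply/count_memPn/mapP => -[]|by rewrite /= ?andbF]).
have /min_letterP[mw wm] : letters w != [::] by case: w w0 {wn}.
set m := min_letter _ in mw wm.
have K := @flat_prod_dual m n w Sn; rewrite mw addn1 ltnS in K.
have {K} := K wn => K.
have F0 : (flat_word m w).1 != [::] by rewrite flat_word_nilP mw.
have min_in p : p \in splits w -> p.1 != [::] -> p.2 != [::] ->
    [/\ m <= min_letter (letters p.1), m <= min_letter (letters p.2),
    (m \in letters p.1) = (min_letter (letters p.1) == m),
    (m \in letters p.2) = (min_letter (letters p.2) == m) &
    (m \in letters p.1) || (m \in letters p.2)].
  move=> /splits_cat pw p10 p20.
  have /min_letterP[p1 p1m] : letters p.1 != [::] by case: (p.1) p10.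
  have /min_letterP[p2 p2m] : letters p.2 != [::] by case: (p.2) p20.
  have wE x : (x \in letters w) = (x \in letters p.1) || (x \in letters p.2).
    by rewrite -pw /letters /unzip1 map_cat mem_cat.
  have m1 : m <= min_letter (letters p.1) by apply: wm; rewrite wE p1.
  have m2 : m <= min_letter (letters p.2) by apply: wm; rewrite wE p2 orbT.
  split; rewrite // -?wE //; apply/idP/eqP => [h|<- //]; apply/eqP; rewrite eqn_leq.
    by rewrite p1m.
  by rewrite p2m.
have le_in p : p \in splits w -> {in letters p.1, forall x, m <= x} /\
    {in letters p.2, forall x, m <= x}.
  move=> /splits_cat pw; split=> x xp; apply: wm;
  by rewrite -pw /letters /unzip1 map_cat mem_cat xp ?orbT.
have nN v t : wtree v == Some t -> v != [::].
  by apply: contraTneq => ->; rewrite wtree_nil.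
have wtE : wtree w = graft (flat_word m w) by apply: wtreeE.
(* The parts have nonempty trees, so they are nonempty. Both minima are at least [m] and one of them
   equals [m], so comparing them amounts to testing each against [m]. *)
split=> t t'; rewrite wtE ?map_Some_prec ?map_Some_succ ?map_Some_bul
    count_map_graft ?flat_prod_neq_nil //; try (by [case: t | case: t']);
  rewrite K; apply: eq_in_count => p ps; have [l1 l2] := le_in p ps;
  rewrite ?flat_word_flatten_tree ?flat_word_nil_tree // andbACA;
  (case: (wtree p.1 =P Some t) => [/eqP/nN p1|]; last by rewrite ?andbF);
  (case: (wtree p.2 =P Some t') => [/eqP/nN p2|]; last by rewrite ?andbF);
  rewrite !andbT; have [+ + e1 e2] := min_in _ ps p1 p2; rewrite e1 e2;
  by move: (min_letter _) (min_letter _) => x y /=; clear; lia.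
Qed.

(** Strong induction on the length: ⋆-duality for shorter words gives the three dualities for [w],
    whose sum is ⋆-duality for [w] since exactly one of <, >, = holds. The trivial cuts correspond
    to the unit |. *)
Lemma star_dualP (w : dword) : star_dual w.
Proof.
have [n] := ubnP (size w); elim: n w => // n IH w; rewrite ltnS => wn.
have [Hp Hs Hb] := op_dual_of_star_dual IH wn.
case=> [t|] t'; last first.
  rewrite (_ : unital _ _ _ = [:: t']); last by case: t'.
  rewrite /= addn0 eq_sym -(count_splits_nill (fun v => wtree v == t')).
  by apply: eq_count => p /=; rewrite wtree_eq_None.
case: t' => [t'|]; last first.
  rewrite /= addn0 eq_sym -(count_splits_nilr (fun v => wtree v == Some t)).
  by apply: eq_count => p /=; rewrite wtree_eq_None.
rewrite /= star_treesE !map_cat !count_cat Hp Hs Hb.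
elim: (splits w) => //= p s <-; rewrite !addnA.
by case: ltngtP; case: (wtree p.1 == _); case: (wtree p.2 == _) => /=; lia.
Qed.

Lemma op_dualP (w : dword) :
  [/\ op_dual prec_trees ltn w, op_dual succ_trees gtn w & op_dual bul_trees eq_op w].
Proof. by apply: (@op_dual_of_star_dual (size w)) => // v _; apply: star_dualP. Qed.

Local Open Scope ring_scope.

(** * Words as functions *)

Section Linear.
Variables (k : fieldType) (U V : lmodType k) (f : U -> V).
Hypothesis lf : linear f.

Lemma linear_fun0 : f 0 = 0.
Proof. by have := lf (-1) 0 0; rewrite scaler0 addr0 scaleN1r addNr. Qed.

Lemma linear_funD x y : f (x + y) = f x + f y.
Proof. by have := lf 1 x y; rewrite !scale1r. Qed.

Lemma linear_funZ a x : f (a *: x) = a *: f x.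
Proof. by have := lf a x 0; rewrite !addr0 linear_fun0 addr0. Qed.

Lemma linear_fun_sum I (r : seq I) (F : I -> U) :
  f (\sum_(i <- r) F i) = \sum_(i <- r) f (F i).
Proof. by apply: (big_morph f linear_funD linear_fun0). Qed.

End Linear.

Lemma linear_comp (k : fieldType) (U V W : lmodType k) (g : V -> W) (f : U -> V) :
  linear g -> linear f -> linear (fun x => g (f x)).
Proof. by move=> lg lf a x y; rewrite lf lg. Qed.

Section Freeg.
Variables (k : fieldType) (I : choiceType).
Implicit Types (V : lmodType k).

Lemma freegUE (c : k) (i : I) : << c *g i >> = c *: << i >> :> {freeg I / k}.
Proof. by apply/eqP/freeg_eqP => j; rewrite coeffZ !coeffU mul1r. Qed.

Lemma fglift_linear V (f : I -> V) : linear (fglift f : {freeg I / k} -> V).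
Proof.
have fB := lift_is_additive f.
have f0 : fglift f 0 = 0 by have := fB 0 0; rewrite !subr0 subrr.
have fD x y : fglift f (x + y) = fglift f x + fglift f y.
  by rewrite -[in LHS](opprK y) fB -(sub0r y) fB f0 sub0r opprK.
move=> a x y; rewrite fD; congr (_ + _).
rewrite -{2}[x]freeg_sumE [a *: x]/(fgscale a x) /fgscale.
rewrite !(big_morph _ fD f0) scaler_sumr; apply: eq_bigr => i _.
by rewrite !liftU scalerA.
Qed.

Lemma fgliftU V (f : I -> V) i : fglift f (<< i >> : {freeg I / k}) = f i.
Proof. by rewrite liftU scale1r. Qed.

Lemma coeff_linear (i : I) : linear (coeff i : {freeg I / k} -> k^o).
Proof. by move=> a x y; rewrite coeffD coeffZ. Qed.

Lemma freeg_linear_eq V (f g : {freeg I / k} -> V) : linear f -> linear g ->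
  (forall i, f << i >> = g << i >>) -> f =1 g.
Proof.
move=> lf lg fg x; rewrite -[x]freeg_sumE !linear_fun_sum //.
by apply: eq_bigr => i _; rewrite freegUE !linear_funZ // fg.
Qed.

(** Linearity in the second variable is an equality between two maps which are linear in the first,
    so it is checked on the basis. *)
Lemma bilinear_ext_bilinear V (f : I -> I -> V) (x : {freeg I / k}) :
  linear (bilinear_ext f x) /\ linear ((bilinear_ext f)^~ x).
Proof.
split; last exact: fglift_linear.
move=> a y z; rewrite /bilinear_ext; move: x.
apply: freeg_linear_eq; first exact: fglift_linear.
  move=> b x y'; rewrite !fglift_linear !scalerDr !scalerA [in RHS]mulrC.
  by rewrite -!scalerA addrACA.
by move=> i; rewrite !fgliftU fglift_linear.
Qed.

Lemma bilinear_extU V (f : I -> I -> V) (i j : I) :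
  bilinear_ext f (<< i >> : {freeg I / k}) << j >> = f i j.
Proof. by rewrite /bilinear_ext !fgliftU. Qed.

Lemma bilinear_eq V (f g : {freeg I / k} -> {freeg I / k} -> V) :
  (forall x, linear (f x)) -> (forall y, linear (f^~ y)) ->
  (forall x, linear (g x)) -> (forall y, linear (g^~ y)) ->
  (forall i j, f << i >> << j >> = g << i >> << j >>) -> forall x y, f x y = g x y.
Proof.
move=> f1 f2 g1 g2 fg x y; move: x.
apply: freeg_linear_eq; [exact: f2|exact: g2|] => i; move: y.
by apply: freeg_linear_eq; [exact: f1|exact: g1|].
Qed.

Lemma coeff_fsum (A : set I) (i : I) : finite_set A ->
  coeff i (\sum_(j \in A) (<< j >> : {freeg I / k})) = (i \in A)%:R.
Proof.
move=> /finite_seqP[r ->].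
have -> : [set` r]%classic = [set` undup r]%classic.
  by apply/seteqP; split=> x /=; rewrite mem_undup.
rewrite -fsbig_seq ?undup_uniq // raddf_sum.
rewrite (eq_bigr (fun j => (j == i)%:R)) => [|j _]; last by rewrite /= coeffU mul1r.
have -> : (i \in [set` undup r]%classic) = (i \in undup r).
  by apply/idP/idP; rewrite inE.
have [ir|ir] := boolP (i \in undup r).
  rewrite (bigD1_seq i) ?undup_uniq //= eqxx big1 ?addr0 // => j /negbTE -> //.
rewrite big1_seq // => j /= jr; case: eqP => // ij; by rewrite -ij jr in ir.
Qed.

End Freeg.

(** A packed word of length n has letters at most n. Finiteness is what gives the sums over shuffles
    and over fibres of [rho] their intended value, as [\sum_(x \in A)] is 0 by default on an
    infinite support. *)
Lemma finite_dpword (D : seq posnat) : finite_set [set w : dpword | decos w = D]%classic.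
Proof.
set n := size D.
pose s := [seq zip (map val (tval l)) D | l <- enum {: n.-tuple 'I_n.+1}].
apply: (@sub_finite_set _ _ [set` pmap insub s]%classic); last exact: finite_seq.
move=> w /= wD; rewrite mem_pmap_sub.
have sz : size (letters w) = n by rewrite /n -wD !size_map.
have ln x : x \in letters w -> (x < n.+1)%N.
  move=> xw; have /andP[pw _] := valP w.
  have : x \in undup (letters w) by rewrite mem_undup.
  rewrite (perm_mem pw) mem_iota add1n => /andP[_ /leq_trans]; apply.
  by rewrite ltnS -sz size_undup.
have sz' : size (map (@inord n) (letters w)) == n by rewrite size_map sz.
apply/mapP; exists (Tuple sz'); first by rewrite mem_enum.
rewrite /= -map_comp (_ : map _ _ = letters w).
  by rewrite -wD /letters /decos zip_unzip.
by apply: map_id_in => x /ln xn /=; rewrite inordK.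
Qed.

Section WordEvaluation.
Variable k : fieldType.

(* x is seen as a function on all decorated words which is constant on the words
   with the same standardization; the products become deconcatenation
   convolutions. *)
Definition word_ev (x : {freeg dpword / k}) (u : dword) : k :=
  if insub (dpack u) is Some w then coeff (w : dpword) x else 0.

Lemma word_ev_linear u : linear (word_ev^~ u : _ -> k^o).
Proof.
move=> a x y; rewrite /word_ev; case: insubP => [w _ _|_]; first exact: coeff_linear.
by rewrite scaler0 addr0.
Qed.

(** The algebra has no unit: trivial cuts must not contribute to the convolutions. *)
Lemma word_ev_nil x : word_ev x [::] = 0.
Proof. by rewrite /word_ev insubF. Qed.

Lemma word_ev_val x (w : dpword) : word_ev x (val w) = coeff w x.
Proof. by rewrite /word_ev dpack_id ?valK //; have /andP[] := valP w. Qed.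

Lemma word_ev_inj x y : word_ev x =1 word_ev y -> x = y.
Proof. by move=> xy; apply/eqP/freeg_eqP => w; rewrite -!word_ev_val. Qed.

Lemma word_evU (v : dpword) u : word_ev << v >> u = (dpack u == val v)%:R.
Proof.
rewrite /word_ev; case: insubP => [w _ <-|].
  by rewrite coeffU mul1r eq_sym val_eqE.
by apply: contraNeq; case: (dpack u =P val v) => [->|_]; rewrite ?eqxx // (valP v).
Qed.

(** Arbitrary functions are allowed so that convolutions can be iterated. On an empty factor
    [min_letter] has the default value 0, which is harmless for functions vanishing at the empty
    word. *)
Definition conv (cmp : rel nat) (X Y : dword -> k) (u : dword) : k :=
  \sum_(p <- splits u)
    (cmp (min_letter (letters p.1)) (min_letter (letters p.2)))%:R * (X p.1 * Y p.2).

Lemma conv_bilinear cmp u :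
  (forall x, linear (fun y => conv cmp (word_ev x) (word_ev y) u : k^o)) /\
  (forall y, linear (fun x => conv cmp (word_ev x) (word_ev y) u : k^o)).
Proof.
split=> z a x y; rewrite /conv scaler_sumr -big_split; apply: eq_bigr => p _ /=;
  rewrite word_ev_linear /GRing.scale /= ; ring.
Qed.

End WordEvaluation.

Lemma count_splits_size (T : eqType) (P : pred (seq T * seq T)) (u : seq T) (i : nat) :
  count (fun p => (size p.1 == i) && P p) (splits u) =
  ((i <= size u)%N && P (take i u, drop i u)).
Proof.
elim: u i P => [|a u IH] [|i] P /=; rewrite ?addn0 ?eqxx //.
  by rewrite count_map (@eq_count _ _ pred0) ?count_pred0 ?addn0.
by rewrite add0n count_map -(IH i (fun p => P (a :: p.1, p.2))).
Qed.

Lemma sum_splits_coassoc (V : nmodType) (T : Type)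
    (F : seq T -> seq T -> seq T -> V) (u : seq T) :
  \sum_(p <- splits u) \sum_(q <- splits p.1) F q.1 q.2 p.2 =
  \sum_(p <- splits u) \sum_(q <- splits p.2) F p.1 q.1 q.2.
Proof.
elim: u F => [|a u IH] F; first by rewrite !big_seq1.
rewrite /= !big_cons !big_map /= big_nil addr0 -addrA; congr (_ + _).
rewrite -(IH (fun x => F (a :: x))) -[RHS]big_split; apply: eq_bigr => p _ /=.
by rewrite big_cons big_map.
Qed.

Lemma sum_natr_count (R : pzSemiRingType) (T : Type) (P : pred T) (s : seq T) :
  \sum_(x <- s) (P x)%:R = (count P s)%:R :> R.
Proof. by elim: s => [|x s IH]; rewrite ?big_nil // big_cons IH natrD. Qed.

(** What is needed for a comparison of minima to survive standardization. *)
Definition order_invariant (cmp : rel nat) : Prop := forall f u,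
  increasing_on f u -> {in u &, forall x y, cmp (f x) (f y) = cmp x y}.

Lemma order_invariant_ltn : order_invariant ltn.
Proof. by move=> f u fu x y xu yu; rewrite /= !ltnNge fu. Qed.

Lemma order_invariant_gtn : order_invariant gtn.
Proof. by move=> f u fu x y xu yu; rewrite /= !ltnNge fu. Qed.

Lemma order_invariant_eq : order_invariant eq_op.
Proof. by move=> f u fu x y xu yu; rewrite /= !eqn_leq !fu. Qed.

Lemma finite_shuffles cmp v w : finite_set (shuffles cmp v w).
Proof.
apply: (@sub_finite_set _ _ [set x : dpword | decos x = decos v ++ decos w]%classic).
  by move=> x [].
exact: finite_dpword.
Qed.

Lemma dpack_eqE (a : dword) (v : dpword) :
  (dpack a == v :> dword) = (pack (letters a) == letters v) && (decos a == decos v).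
Proof.
apply/eqP/andP => [<-|[/eqP h1 /eqP h2]]; first by rewrite letters_dpack decos_dpack.
by rewrite -[RHS]zip_unzip -/(letters v) -/(decos v) -h1 -h2.
Qed.

Lemma dpword_neq_nil (v : dpword) : v != [::] :> dword.
Proof. by have /andP[] := valP v. Qed.

(** Membership of a packed word in a shuffle set can be read on any word [u] with that
    standardization: prefixes and suffixes of [u] and of its packing differ by an increasing
    relabelling. *)
Lemma shuffles_dpack cmp (v w x : dpword) (u : dword) : order_invariant cmp ->
  dpack u = x ->
  (x \in shuffles cmp v w) = (size v <= size u)%N &&
   [&& cmp (min_letter (letters (take (size v) u))) (min_letter (letters (drop (size v) u))),
       dpack (take (size v) u) == v & dpack (drop (size v) u) == w].
Proof.
move=> ocmp ux; rewrite !dpack_eqE.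
have xl : letters x = map (rank (letters u)) (letters u) by rewrite -ux letters_dpack.
have xd : decos x = decos u by rewrite -ux decos_dpack.
have inc := rank_increasing (u := letters u).
have incs s : {subset s <= letters u} -> increasing_on (rank (letters u)) s.
  by move=> su a b /su au /su bu; apply: inc.
have st : {subset take (size v) (letters u) <= letters u} by move=> a /mem_take.
have sd : {subset drop (size v) (letters u) <= letters u} by move=> a /mem_drop.
have -> : letters (take (size v) u) = take (size v) (letters u).
  by rewrite /letters /unzip1 map_take.
have -> : letters (drop (size v) u) = drop (size v) (letters u).
  by rewrite /letters /unzip1 map_drop.
have -> : decos (take (size v) u) = take (size v) (decos u).
  by rewrite /decos /unzip2 map_take.
have -> : decos (drop (size v) u) = drop (size v) (decos u).
  by rewrite /decos /unzip2 map_drop.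
have ptake : pack (take (size v) (letters x)) = pack (take (size v) (letters u)).
  by rewrite xl -map_take pack_map //; apply: incs.
have pdrop : pack (drop (size v) (letters x)) = pack (drop (size v) (letters u)).
  by rewrite xl -map_drop pack_map //; apply: incs.
have sl : size (letters u) = size u by rewrite size_map.
have su : size (decos u) = size u by rewrite size_map.
have sv : size (decos v) = size v by rewrite size_map.
(* Both hypotheses ensure that the two parts are nonempty: the default minimum of an empty word is
   not transported by [rank]. *)
have cmpE : pack (take (size v) (letters u)) = letters v ->
    pack (drop (size v) (letters u)) = letters w ->
    cmp (min_letter (take (size v) (letters x))) (min_letter (drop (size v) (letters x)))
    = cmp (min_letter (take (size v) (letters u))) (min_letter (drop (size v) (letters u))).
  have nz (z : dpword) s : pack s = letters z -> s != [::].
    by move=> h; rewrite -size_eq0 -(size_pack s) h size_map size_eq0 dpword_neq_nil.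
  move=> /nz t0 /nz d0; rewrite xl -map_take -map_drop !min_letter_map //; try exact: incs.
  have [t1 _] := min_letterP t0; have [d1 _] := min_letterP d0.
  by rewrite (ocmp _ _ inc) //; [exact: st|exact: sd].
apply/idP/and4P => [|[vu cm /andP[/eqP h1 /eqP h2] /andP[/eqP h3 /eqP h4]]].
  rewrite inE => -[hd h1 h2]; rewrite -ptake -pdrop in cmpE *.
  rewrite cmpE // => ->; rewrite h1 h2 !eqxx -xd hd -sv take_size_cat // drop_size_cat //.
  by split; rewrite ?eqxx // -su -xd hd size_cat leq_addr.
by rewrite inE; split; rewrite ?ptake ?pdrop ?cmpE // xd -h2 -h4 cat_take_drop.
Qed.

(** * The NQSh axioms for words *)

Section Algebra.
Variable k : fieldType.
Implicit Types (x y : {freeg dpword / k}).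

Lemma word_ev_op cmp x y u : order_invariant cmp ->
  word_ev (word_op cmp x y) u = conv cmp (word_ev x) (word_ev y) u.
Proof.
move=> ocmp; pose F x y : k^o := word_ev (word_op cmp x y) u.
pose G x y : k^o := conv cmp (word_ev x) (word_ev y) u.
have [G1 G2] := conv_bilinear k cmp u.
apply: (bilinear_eq (f := F) (g := G)) => // [{}x|{}y|v w]; rewrite /F /G.
- exact: (linear_comp (@word_ev_linear k u) (bilinear_ext_bilinear _ x).1).
- exact: (linear_comp (@word_ev_linear k u) (bilinear_ext_bilinear _ y).2).
rewrite /word_op bilinear_extU.
(* A factor packing to [v] has the length of [v]; making this condition explicit leaves at most one
   cut of [u] to examine. *)
have -> : conv cmp (word_ev (<<v>> : {freeg dpword / k})) (word_ev << w >>) u =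
   (count (fun p => (size p.1 == size v) && 
   [&& cmp (min_letter (letters p.1)) (min_letter (letters p.2)),
       dpack p.1 == v & dpack p.2 == w]) (splits u))%:R.
  rewrite /conv -sum_natr_count; apply: eq_bigr => p _; rewrite !word_evU -!natrM !mulnb.
  congr (nat_of_bool _)%:R; case: (dpack p.1 =P v) => [e|]; rewrite ?andbF //.
  by rewrite -(size_dpack p.1) e eqxx.
rewrite count_splits_size /= /word_ev; case: insubP => [z _ zE|u0].
  by rewrite coeff_fsum ?(shuffles_dpack _ _ ocmp (esym zE)) //; exact: finite_shuffles.
rewrite (_ : _ && _ = false) //; apply/negP => /andP[vu _].
move: u0; rewrite packed_dpack /= negbK -size_eq0 size_dpack => /eqP u0.
by have := dpword_neq_nil v; rewrite -size_eq0 -leqn0 (leq_trans vu) ?u0.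
Qed.

(** Both sides are sums over the factorizations of [u] into three words. Empty factors contribute 0,
    and otherwise the minimum of a concatenation is the minimum of the two minima, so only the
    stated identity on three integers remains. *)
Lemma conv_assoc (c1 c2 c3 c4 : rel nat) (X Y Z : dword -> k) (u : dword) :
  X [::] = 0 -> Y [::] = 0 -> Z [::] = 0 ->
  (forall p q r, c1 p q && c2 (minn p q) r = c3 p (minn q r) && c4 q r) ->
  conv c2 (conv c1 X Y) Z u = conv c3 X (conv c4 Y Z) u.
Proof.
move=> X0 Y0 Z0 cE.
pose m (v : dword) := min_letter (letters v).
pose F (a b c : dword) : k :=
  (c1 (m a) (m b) && c2 (m (a ++ b)) (m c))%:R * (X a * Y b * Z c).
pose G (a b c : dword) : k :=
  (c3 (m a) (m (b ++ c)) && c4 (m b) (m c))%:R * (X a * Y b * Z c).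
have -> : conv c2 (conv c1 X Y) Z u =
    \sum_(p <- splits u) \sum_(q <- splits p.1) F q.1 q.2 p.2.
  apply: eq_bigr => p _; rewrite /conv mulr_suml mulr_sumr.
  rewrite [LHS]big_seq [RHS]big_seq; apply: eq_bigr => q /splits_cat <-.
  by rewrite /F -mulnb natrM; ring.
have -> : conv c3 X (conv c4 Y Z) u =
    \sum_(p <- splits u) \sum_(q <- splits p.2) G p.1 q.1 q.2.
  apply: eq_bigr => p _; rewrite /conv !mulr_sumr.
  rewrite [LHS]big_seq [RHS]big_seq; apply: eq_bigr => q /splits_cat <-.
  by rewrite /G -mulnb natrM; ring.
rewrite sum_splits_coassoc; apply: eq_bigr => p _; apply: eq_bigr => q _; rewrite /F /G.
have [->|a0] := eqVneq p.1 [::]; first by rewrite X0 !mul0r !mulr0.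
have [->|b0] := eqVneq q.1 [::]; first by rewrite Y0 mulr0 !mul0r !mulr0.
have [->|d0] := eqVneq q.2 [::]; first by rewrite Z0 !mulr0.
have l0 (v : dword) : v != [::] -> letters v != [::] by case: v.
by rewrite /m /letters /unzip1 !map_cat !min_letter_cat ?l0 // cE.
Qed.

Lemma eq_conv cmp (X X' Y Y' : dword -> k) u : X =1 X' -> Y =1 Y' ->
  conv cmp X Y u = conv cmp X' Y' u.
Proof. by move=> XE YE; apply: eq_bigr => p _; rewrite XE YE. Qed.

Lemma word_ev_prec (x y : QShd k) :
  word_ev (x ≺ y)%nqsh =1 conv ltn (word_ev x) (word_ev y).
Proof. by move=> u; exact: word_ev_op order_invariant_ltn. Qed.

Lemma word_ev_succ (x y : QShd k) :
  word_ev (x ≻ y)%nqsh =1 conv gtn (word_ev x) (word_ev y).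
Proof. by move=> u; exact: word_ev_op order_invariant_gtn. Qed.

Lemma word_ev_bul (x y : QShd k) :
  word_ev (x • y)%nqsh =1 conv eq_op (word_ev x) (word_ev y).
Proof. by move=> u; exact: word_ev_op order_invariant_eq. Qed.

Lemma word_ev_star (x y : QShd k) :
  word_ev (x ⋆ y)%nqsh =1 conv (fun _ _ => true) (word_ev x) (word_ev y).
Proof.
move=> u; have lev := @word_ev_linear k u.
rewrite /nstar (linear_funD lev) (linear_funD lev) /= word_ev_prec word_ev_succ word_ev_bul.
rewrite /conv -!big_split /=; apply: eq_bigr => p _; rewrite -!mulrDl; congr (_ * _).
by case: ltngtP; rewrite ?addr0 ?add0r.
Qed.

Lemma QShd_is_NQSh : is_NQSh (QShd k).
Proof.
have ax (o1 o2 o3 o4 : QShd k -> QShd k -> QShd k) c1 c2 c3 c4 :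
  (forall x y, word_ev (o1 x y) =1 conv c1 (word_ev x) (word_ev y)) ->
  (forall x y, word_ev (o2 x y) =1 conv c2 (word_ev x) (word_ev y)) ->
  (forall x y, word_ev (o3 x y) =1 conv c3 (word_ev x) (word_ev y)) ->
  (forall x y, word_ev (o4 x y) =1 conv c4 (word_ev x) (word_ev y)) ->
  (forall p q r, c1 p q && c2 (minn p q) r = c3 p (minn q r) && c4 q r) ->
  forall x y z, o2 (o1 x y) z = o3 x (o4 y z).
  move=> h1 h2 h3 h4 cE x y z; apply: word_ev_inj => u; rewrite h2 h3.
  rewrite (eq_conv _ _ (h1 x y) (fun=> erefl)) [RHS](eq_conv _ _ (fun=> erefl) (h4 y z)).
  by apply: conv_assoc; rewrite ?word_ev_nil.
have bil := bilinear_ext_bilinear.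
split; try (by split=> x; [exact: (bil _ _ _ _ x).1|exact: (bil _ _ _ _ x).2]).
- move=> x y z; apply/esym; move: x y z.
  by apply: (ax) word_ev_bul word_ev_bul word_ev_bul word_ev_bul _ => p q r; lia.
- by apply: (ax) word_ev_prec word_ev_prec word_ev_prec word_ev_star _ => p q r /=; lia.
- by apply: (ax) word_ev_succ word_ev_prec word_ev_succ word_ev_prec _ => p q r /=; lia.
- by apply: (ax) word_ev_star word_ev_succ word_ev_succ word_ev_succ _ => p q r /=; lia.
- by apply: (ax) word_ev_prec word_ev_bul word_ev_bul word_ev_succ _ => p q r /=; lia.
- by apply: (ax) word_ev_succ word_ev_bul word_ev_succ word_ev_bul _ => p q r /=; lia.
- by apply: (ax) word_ev_bul word_ev_prec word_ev_bul word_ev_prec _ => p q r /=; lia.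
Qed.

End Algebra.

(** * The morphism Omega *)

Section TreeInd.
Variable P : tree -> Prop.
Hypothesis P_leaf : P None.
Hypothesis P_graft : forall t1 d1 s l, P t1 -> foldr (fun p Q => P p.1 /\ Q) True s ->
  P l -> P (Some (Graft t1 d1 s l)).

(** Subtrees are nested inside [option] and [seq]; the [foldr] in [P_graft] is a conjunction over
    the list that unfolds by computation. *)
Lemma tree_ind (t : tree) : P t.
Proof.
case: t => // ; fix rec 1 => -[t1 d1 s l]; apply: P_graft.
- by case: t1.
- by elim: s => //= -[[t|] d] s IH; split=> /=.
- by case: l.
Qed.

End TreeInd.

Lemma wtree_surj (t : tree) : exists u, wtree u = t.
Proof.
elim/tree_ind: t => [|t1 d1 s l IH1 IHs IHl]; first by exists [::].
have shiftP v : 0%N \notin letters (relabel S v) /\ wtree (relabel S v) = wtree v.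
  split; last by apply: wtree_relabel => x y _ _; rewrite ltnS.
  by rewrite letters_relabel; apply/mapP => -[].
suff [u uE] : exists u, flat_word 0 u = ((t1, d1) :: s, l).
  by exists u; rewrite (@wtreeE 0) // uE.
elim: s t1 d1 IH1 IHs => [|[t d] s IH] t1 d1 [v1 <-] /=.
  move=> _; case: IHl => vl <-; have [n1 <-] := shiftP v1; have [nl <-] := shiftP vl.
  exists (relabel S v1 ++ (0%N, d1) :: relabel S vl).
  by rewrite flat_word_cat_cons // flat_word_notin.
case=> IHt /(IH t d IHt)[u uE]; have [n1 <-] := shiftP v1.
by exists (relabel S v1 ++ (0%N, d1) :: u); rewrite flat_word_cat_cons // uE.
Qed.

Fixpoint tree_decos (t : stree) : seq posnat :=
  let: Graft t1 d1 s l := t in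
  oapp tree_decos [::] t1 ++ d1 ::
  flatten [seq rcons (oapp tree_decos [::] p.1) p.2 | p <- s] ++ oapp tree_decos [::] l.

(** A tree, read from left to right, remembers the decorations of its words; hence the fibres of
    [rho] are finite. *)
Lemma tree_decos_wtree u : oapp tree_decos [::] (wtree u) = decos u.
Proof.
have [n] := ubnP (size u); elim: n u => // n IH u; rewrite ltnS => un.
have [->//|u0] := eqVneq u [::].
have /min_letterP[mu um] : letters u != [::] by case: u u0 {un}.
set m := min_letter _ in mu um.
pose D (A : flat) := flatten [seq rcons (oapp tree_decos [::] p.1) p.2 | p <- A.1]
  ++ oapp tree_decos [::] A.2.
have -> : oapp tree_decos [::] (wtree u) = D (flat_word m u).
  rewrite (wtreeE um) /D /graft; case: (flat_word m u) => -[|[t d] s] l //=.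
  by rewrite -cats1 -!catA.
(* As in [flat_prod_dual], words without [m] go to the induction on the length and must be shorter
   than [n]. *)
suff DE v : (size v < n + (m \in letters v))%N -> D (flat_word m v) = decos v.
  by apply: DE; rewrite mu addn1 ltnS.
elim/(@wordP m): v => [v nv|a d b na IHb].
  by rewrite (negbTE nv) addn0 => /IH; rewrite flat_word_notin.
rewrite /letters /unzip1 map_cat mem_cat size_cat /= inE eqxx orbT /= => sz.
rewrite flat_word_cat_cons // /D /= IH; last by lia.
by rewrite -cats1 -!catA /= -/(D (flat_word m b)) IHb; [rewrite /decos /unzip2 map_cat|lia].
Qed.

Section Omega.
Variable k : fieldType.

Lemma finite_rho_fiber (t : stree) : finite_set [set w : dpword | rho w = Some t]%classic.
Proof.
apply: (@sub_finite_set _ _ [set w : dpword | decos w = tree_decos t]%classic).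
  move=> w /= wt; rewrite -tree_decos_wtree /wtree dpack_id ?wt //.
  by have /andP[] := valP w.
exact: finite_dpword.
Qed.

Definition tree_ev (x : {freeg stree / k}) (t : tree) : k :=
  if t is Some u then coeff u x else 0.

Lemma tree_ev_linear t : linear (tree_ev^~ t : _ -> k^o).
Proof.
move=> a x y; case: t => [t|] /=; first exact: coeff_linear.
by rewrite scaler0 addr0.
Qed.

Lemma tree_evU (u : stree) t : tree_ev << u >> t = (t == Some u)%:R.
Proof.
case: t => [t|] //=; rewrite coeffU mul1r; congr (nat_of_bool _)%:R.
by apply/eqP/eqP => [->|[->]].
Qed.

Lemma Omega_linear : linear (@Omega k).
Proof. exact: fglift_linear. Qed.

(** On functions, [Omega] is composition with [wtree]. On a basis tree both sides are the indicator
    function of a fibre. *)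
Lemma word_ev_Omega (x : treeNQSh k) u : word_ev (Omega x) u = tree_ev x (wtree u).
Proof.
pose F x : k^o := word_ev (Omega x) u; pose G x : k^o := tree_ev x (wtree u).
apply: (freeg_linear_eq (f := F) (g := G)) => {x} [||t]; rewrite /F /G.
- exact: (linear_comp (@word_ev_linear k u) Omega_linear).
- exact: tree_ev_linear.
rewrite tree_evU /Omega fgliftU /word_ev; case: insubP => [w _ wE|].
  rewrite coeff_fsum; last exact: finite_rho_fiber.
  rewrite /wtree -wE; congr (nat_of_bool _)%:R.
  by apply/idP/eqP; rewrite inE.
rewrite packed_dpack /= negbK -size_eq0 size_dpack size_eq0 => /eqP ->.
by rewrite wtree_nil.
Qed.

Lemma Omega_inj : injective (@Omega k).
Proof.
move=> x y xy; apply/eqP/freeg_eqP => t; have [u ut] := wtree_surj (Some t).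
by have := word_ev_Omega x u; rewrite xy word_ev_Omega ut.
Qed.

(** On basis trees the left side is the multiplicity of [wtree u] in the product and the right side
    counts admissible cuts of [u]: this is [op_dual]. *)
Lemma Omega_op op cmp (x y : treeNQSh k) u : op_dual op cmp u ->
  tree_ev (tree_op op x y) (wtree u) = conv cmp (word_ev (Omega x)) (word_ev (Omega y)) u.
Proof.
move=> od; pose F x y : k^o := tree_ev (tree_op op x y) (wtree u).
pose G x y : k^o := conv cmp (word_ev (@Omega k x)) (word_ev (Omega y)) u.
have [G1 G2] := conv_bilinear k cmp u.
apply: (bilinear_eq (f := F) (g := G)) => [{}x|{}y|{}x|{}y|t t']; rewrite /F /G.
- exact: (linear_comp (@tree_ev_linear (wtree u)) (bilinear_ext_bilinear _ x).1).
- exact: (linear_comp (@tree_ev_linear (wtree u)) (bilinear_ext_bilinear _ y).2).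
- exact: (linear_comp (G1 _) Omega_linear).
- exact: (linear_comp (G2 _) Omega_linear).
rewrite /tree_op bilinear_extU.
have lt := @tree_ev_linear (wtree u); rewrite (linear_fun_sum lt).
under eq_bigr do rewrite tree_evU eq_sym.
rewrite sum_natr_count -(count_map Some (fun t => t == wtree u)) od.
rewrite -sum_natr_count; apply: eq_bigr => p _.
by rewrite !word_ev_Omega !tree_evU -!natrM !mulnb.
Qed.

Lemma Omega_morphism : nqsh_morphism (@Omega k).
Proof.
split; first exact: Omega_linear.
- move=> x y; apply: word_ev_inj => u; have [d _ _] := op_dualP u.
  by rewrite word_ev_Omega word_ev_prec; apply: Omega_op.
- move=> x y; apply: word_ev_inj => u; have [_ d _] := op_dualP u.
  by rewrite word_ev_Omega word_ev_succ; apply: Omega_op.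
- move=> x y; apply: word_ev_inj => u; have [_ _ d] := op_dualP u.
  by rewrite word_ev_Omega word_ev_bul; apply: Omega_op.
Qed.

End Omega.

(** * Transport of structure along morphisms *)

Section Morphisms.
Variable k : fieldType.

Lemma nqsh_morphism_star (A B : nqshData k) (f : A -> B) : nqsh_morphism f ->
  {morph f : x y / (x ⋆ y)%nqsh}.
Proof.
move=> mf x y; have lf := nmor_linear mf.
by rewrite /nstar !(linear_funD lf) (nmor_prec mf) (nmor_succ mf) (nmor_bul mf).
Qed.

Lemma is_NQSh_injective (A B : nqshData k) (f : A -> B) :
  is_bilinear (@nprec k A) -> is_bilinear (@nsucc k A) -> is_bilinear (@nbul k A) ->
  nqsh_morphism f -> injective f -> is_NQSh B -> is_NQSh A.
Proof.
move=> b1 b2 b3 mf fI nB.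
have fE := (nmor_prec mf, nmor_succ mf, nmor_bul mf, nqsh_morphism_star mf).
split=> // x y z; apply: fI; rewrite !fE.
- exact: nbulA.
- exact: nprecA.
- exact: nsucc_prec.
- exact: nsuccA.
- exact: nprec_bul.
- exact: nsucc_bul.
- exact: nbul_prec.
Qed.

Lemma nqsh_morphism_comp (A B C : nqshData k) (g : B -> C) (f : A -> B) :
  nqsh_morphism g -> nqsh_morphism f -> nqsh_morphism (g \o f).
Proof.
move=> mg mf; split; first exact: (linear_comp (nmor_linear mg) (nmor_linear mf)).
- by move=> x y; rewrite /= (nmor_prec mf) (nmor_prec mg).
- by move=> x y; rewrite /= (nmor_succ mf) (nmor_succ mg).
- by move=> x y; rewrite /= (nmor_bul mf) (nmor_bul mg).
Qed.

Lemma nqsh_morphism_inv (A B : nqshData k) (f : A -> B) (g : B -> A) :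
  nqsh_morphism f -> cancel f g -> cancel g f -> nqsh_morphism g.
Proof.
move=> mf fg gf; have fI := can_inj fg; split.
- by move=> a x y; apply: fI; rewrite (nmor_linear mf) !gf.
- by move=> x y; apply: fI; rewrite (nmor_prec mf) !gf.
- by move=> x y; apply: fI; rewrite (nmor_succ mf) !gf.
- by move=> x y; apply: fI; rewrite (nmor_bul mf) !gf.
Qed.

Lemma free_NQSh_on_iso (X : Type) (A B : nqshData k) (i : X -> A) (f : A -> B) :
  free_NQSh_on i -> is_NQSh B -> nqsh_morphism f -> bijective f ->
  free_NQSh_on (f \o i).
Proof.
move=> [_ uA] nB mf [g fg gf]; split=> // C nC h.
have [phi [[mphi phiE] phiU]] := uA C nC h.
exists (phi \o g); split.
  split; first exact: nqsh_morphism_comp mphi (nqsh_morphism_inv mf fg gf).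
  by rewrite -phiE; apply: funext => x /=; rewrite fg.
move=> psi [mpsi psiE]; rewrite (phiU (psi \o f)).
  by apply: funext => x /=; rewrite gf.
by split; [exact: nqsh_morphism_comp|rewrite -psiE].
Qed.

Lemma treeNQSh_bilinear op : is_bilinear (@tree_op k op).
Proof.
pose f t t' : {freeg stree / k} := \sum_(u <- op t t') << u >>.
by split=> x; have [] := bilinear_ext_bilinear f x.
Qed.

Lemma treeNQSh_is_NQSh : is_NQSh (treeNQSh k).
Proof.
by apply: (is_NQSh_injective _ _ _ (Omega_morphism k) (@Omega_inj k) (QShd_is_NQSh k));
  apply: treeNQSh_bilinear.
Qed.

End Morphisms.

(** * Freeness *)

Section Interpretation.
Variables (k : fieldType) (A : nqshData k) (f : posnat -> A).

(* t_1 ∨_{d_1} ... ∨_{d_{m-1}} t_m is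
   ((t_1 ≻ d_1) • ... • (t_{m-1} ≻ d_{m-1})) ≺ t_m, omitting the t_i equal to |. *)
Fixpoint interp (t : stree) : A :=
  let: Graft t1 d1 s l := t in
  let succ_opt (o : tree) b := if o is Some u then (interp u ≻ b)%nqsh else b in
  let c := foldl (@nbul k A) (succ_opt t1 (f d1)) [seq succ_opt p.1 (f p.2) | p <- s] in
  if l is Some u then (c ≺ interp u)%nqsh else c.

Definition succ_opt (o : tree) (b : A) : A :=
  if o is Some u then (interp u ≻ b)%nqsh else b.

Definition prec_opt (b : A) (o : tree) : A :=
  if o is Some u then (b ≺ interp u)%nqsh else b.

Lemma interpE t1 d1 s l : interp (Graft t1 d1 s l) =
  prec_opt (foldl (@nbul k A) (succ_opt t1 (f d1)) [seq succ_opt p.1 (f p.2) | p <- s]) l.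
Proof. by []. Qed.

Hypothesis nA : is_NQSh A.

Lemma bul_foldl (a b : A) s :
  (a • foldl (@nbul k A) b s)%nqsh = foldl (@nbul k A) (a • b)%nqsh s.
Proof. by elim: s b => //= c s IH b; rewrite IH (nbulA nA). Qed.

Lemma succ_opt_foldl o (b : A) s :
  succ_opt o (foldl (@nbul k A) b s) = foldl (@nbul k A) (succ_opt o b) s.
Proof.
case: o => [t|] //=; elim: s b => //= c s IH b; by rewrite IH (nsucc_bul nA).
Qed.

Lemma prec_opt_bul (a b : A) o : (prec_opt a o • b)%nqsh = (a • succ_opt o b)%nqsh.
Proof. by case: o => //= t; rewrite (nprec_bul nA). Qed.

Lemma bul_prec_opt (a b : A) o : (a • prec_opt b o)%nqsh = prec_opt (a • b)%nqsh o.
Proof. by case: o => //= t; rewrite (nbul_prec nA). Qed.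

Lemma succ_prec_opt (a b : A) o : (a ≻ prec_opt b o)%nqsh = prec_opt (a ≻ b)%nqsh o.
Proof. by case: o => //= t; rewrite (nsucc_prec nA). Qed.

(** Nothing is asked when a tree is |, as [unital] treats the unit separately; this form fits the
    induction on trees. *)
Definition interp_star (t t' : tree) : Prop :=
  match t, t' with
  | Some u, Some u' => \sum_(v <- star_trees u u') interp v = (interp u ⋆ interp u')%nqsh
  | _, _ => True
  end.

Lemma sum_succ_opt t t' b : interp_star t t' ->
  \sum_(u <- unital star_trees t t') succ_opt u b = succ_opt t (succ_opt t' b).
Proof.
case: t t' => [t|] [t'|] //= h; rewrite ?big_seq1 // big_map /=.
by rewrite -(nsuccA nA) -h (linear_fun_sum ((nsucc_bilinear nA).2 b)).
Qed.

Lemma sum_prec_opt t t' b : interp_star t t' ->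
  \sum_(u <- unital star_trees t t') prec_opt b u = prec_opt (prec_opt b t) t'.
Proof.
case: t t' => [t|] [t'|] //= h; rewrite ?big_seq1 // big_map /=.
by rewrite (nprecA nA) -h (linear_fun_sum ((nprec_bilinear nA).1 b)).
Qed.

Lemma foldl_bul_linear s : linear (fun b => foldl (@nbul k A) b s).
Proof.
elim: s => //= c s IH a x y; rewrite -IH; congr foldl; exact: (nbul_bilinear nA).2.
Qed.

Lemma prec_opt_linear o : linear (prec_opt^~ o).
Proof. by case: o => [t|] //=; exact: (nprec_bilinear nA).2. Qed.

Lemma interp_prec t1 d1 s l t' : interp_star l (Some t') ->
  \sum_(v <- prec_trees (Graft t1 d1 s l) t') interp v =
  (interp (Graft t1 d1 s l) ≺ interp t')%nqsh.
Proof.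
move=> h; rewrite /prec_trees big_map.
under eq_bigr do rewrite interpE.
by rewrite sum_prec_opt.
Qed.

Lemma interp_succ t t1 d1 s l : interp_star (Some t) t1 ->
  \sum_(v <- succ_trees t (Graft t1 d1 s l)) interp v =
  (interp t ≻ interp (Graft t1 d1 s l))%nqsh.
Proof.
move=> h; rewrite /succ_trees big_map.
under eq_bigr do rewrite interpE.
rewrite -(linear_fun_sum (prec_opt_linear l)) -(linear_fun_sum (foldl_bul_linear _)).
rewrite sum_succ_opt // interpE succ_prec_opt; congr prec_opt.
by rewrite -(succ_opt_foldl (Some t)).
Qed.

(** The factor ≺ [l] ending the first monomial crosses • and becomes [l] ≻ on the second one, where
    it meets [t1'] and the two merge into their ⋆ product. *)
Lemma interp_bul t1 d1 s l t1' d1' s' l' : interp_star l t1' ->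
  \sum_(v <- bul_trees (Graft t1 d1 s l) (Graft t1' d1' s' l')) interp v =
  (interp (Graft t1 d1 s l) • interp (Graft t1' d1' s' l'))%nqsh.
Proof.
move=> h; rewrite /bul_trees big_map.
under eq_bigr do rewrite interpE map_cat foldl_cat /= -bul_foldl.
rewrite -(linear_fun_sum (prec_opt_linear l')) -(linear_fun_sum ((nbul_bilinear nA).1 _)).
rewrite -(linear_fun_sum (foldl_bul_linear _)) sum_succ_opt //.
by rewrite !interpE bul_prec_opt prec_opt_bul succ_opt_foldl.
Qed.

(** The three parts of ⋆ use the pairs ([l], [t']), ([t], [t1']) and ([l], [t1']): the outer
    induction hypothesis holds for every second tree, the inner one for the fixed first tree. *)
Lemma interp_starP t t' : interp_star t t'.
Proof.
elim/tree_ind: t t' => [|t1 d1 s l _ _ IHl] t'; first by [].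
elim/tree_ind: t' => [|t1' d1' s' l' IH1 _ _]; first by [].
rewrite /interp_star star_treesE !big_cat interp_prec ?interp_succ ?interp_bul //.
exact: addrA.
Qed.

Definition tree_lift : treeNQSh k -> A := fglift interp.

Lemma tree_lift_linear : linear tree_lift.
Proof. exact: fglift_linear. Qed.

Lemma tree_lift_op op (o : A -> A -> A) : is_bilinear o ->
  (forall t t', \sum_(v <- op t t') interp v = o (interp t) (interp t')) ->
  forall x y, tree_lift (tree_op op x y) = o (tree_lift x) (tree_lift y).
Proof.
move=> [o1 o2] ho x y.
pose F x y : A := tree_lift (tree_op op x y); pose G x y := o (tree_lift x) (tree_lift y).
have [b1 b2] := treeNQSh_bilinear k op.
apply: (bilinear_eq (f := F) (g := G)) => [{}x|{}y|{}x|{}y|t t']; rewrite /F /G.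
- exact: (linear_comp tree_lift_linear (b1 x)).
- exact: (linear_comp tree_lift_linear (b2 y)).
- exact: (linear_comp (o1 _) tree_lift_linear).
- exact: (linear_comp (o2 _) tree_lift_linear).
rewrite /tree_op bilinear_extU (linear_fun_sum tree_lift_linear).
under eq_bigr do rewrite /tree_lift fgliftU.
by rewrite ho /tree_lift !fgliftU.
Qed.

Lemma tree_lift_morphism : nqsh_morphism tree_lift.
Proof.
split; first exact: tree_lift_linear.
- apply: tree_lift_op; first exact: nprec_bilinear.
  by move=> [t1 d1 s l] t'; apply: interp_prec; apply: interp_starP.
- apply: tree_lift_op; first exact: nsucc_bilinear.
  by move=> t [t1 d1 s l]; apply: interp_succ; apply: interp_starP.
- apply: tree_lift_op; first exact: nbul_bilinear.
  by move=> [t1 d1 s l] [t1' d1' s' l']; apply: interp_bul; apply: interp_starP.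
Qed.

End Interpretation.

Section Freeness.
Variable k : fieldType.

Lemma morphism_interp (A B : nqshData k) (psi : A -> B) (f : posnat -> A) t :
  nqsh_morphism psi -> psi (interp f t) = interp (psi \o f) t.
Proof.
move=> mpsi.
pose P (o : tree) : Prop :=
  if o is Some u then psi (interp f u) = interp (psi \o f) u else True.
suff : forall o, P o by move/(_ (Some t)).
elim/tree_ind => // t1 d1 s l IH1 IHs IHl.
have succE o b : P o ->
    psi (succ_opt f o b) = succ_opt (psi \o f) o (psi b).
  by case: o => //= u uE; rewrite (nmor_succ mpsi) uE.
have precE o b : P o ->
    psi (prec_opt f b o) = prec_opt (psi \o f) (psi b) o.
  by case: o => //= u uE; rewrite (nmor_prec mpsi) uE.
rewrite /P !interpE precE //; congr prec_opt.
rewrite -(succE t1) //; move: (succ_opt f t1 _) => b.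
elim: s b IHs => //= -[u d] s IH b [IHu /IH{}IH].
by rewrite IH (nmor_bul mpsi) succE.
Qed.

(** Each product met in the monomial of a tree has a single term, because a | always sits where the
    two trees are merged. With [morphism_interp], this shows that a morphism is determined by its
    values on the generators. *)
Lemma interp_tree_gen t : interp (@tree_gen k) t = << t >>.
Proof.
have op1 (op : stree -> stree -> seq stree) u v w : op u v = [:: w] ->
    tree_op op << u >> << v >> = << w >> :> {freeg stree / k}.
  by move=> e; rewrite /tree_op bilinear_extU e big_seq1.
pose P (o : tree) : Prop := if o is Some u then interp (@tree_gen k) u = << u >> else True.
suff : forall o, P o by move/(_ (Some t)).
elim/tree_ind => // t1 d1 s l IH1 IHs IHl; rewrite /P interpE.
have succE o d : P o ->
    succ_opt (@tree_gen k) o (tree_gen k d) = << Graft o d [::] None >>.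
  by case: o => //= u ->; apply: op1.
rewrite succE //.
have -> : foldl (@nbul k (treeNQSh k)) << Graft t1 d1 [::] None >>
    [seq succ_opt (@tree_gen k) p.1 (tree_gen k p.2) | p <- s] = << Graft t1 d1 s None >>.
  (* Generalization to a tree already carrying the list [s0], to which each further factor • appends
     one entry. *)
  rewrite -[in RHS](cat0s s); move: [::] => s0.
  elim: s s0 IHs => [|[u d] s IH] s0 /=; first by rewrite cats0.
  case=> IHu /IH{}IH; rewrite succE // -cat_rcons -IH; congr foldl.
  by apply: op1; rewrite /= cats1.
by case: l IHl => //= u ->; apply: op1.
Qed.

Lemma treeNQSh_free : free_NQSh_on (@tree_gen k).
Proof.
split; first exact: treeNQSh_is_NQSh.
move=> B nB f; exists (tree_lift f); split.
  split; first exact: tree_lift_morphism.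
  by apply: funext => d; rewrite /= /tree_lift /tree_gen fgliftU.
move=> psi [mpsi <-]; apply: funext; apply: freeg_linear_eq.
- exact: tree_lift_linear.
- exact: (nmor_linear mpsi).
- by move=> t; rewrite /tree_lift fgliftU -morphism_interp // interp_tree_gen.
Qed.

Lemma wtree_corolla u d : (wtree u == Some (corolla d)) = (dpack u == [:: (1%N, d)]).
Proof.
apply/eqP/eqP => [|e]; last by rewrite /wtree e.
rewrite /wtree; move: (dpack u) => w; rewrite rhoE.
have wN v : rho (dpack v) = None -> v = [::].
  by move=> /eqP; rewrite -/(wtree v) wtree_eq_None => /eqP.
(* Only the empty word has tree |, so all factors are empty and [cut1K] rebuilds [w] as a single
   letter 1. *)
rewrite {2}[w]cut1K; case: (cut1 w) => -[|[w1 d1] s] l //=.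
case=> /wN -> -> s0 /wN ->; by case: s s0.
Qed.

Lemma Omega_tree_gen d : Omega (tree_gen k d) = word_gen k d.
Proof.
apply: word_ev_inj => u; rewrite word_ev_Omega tree_evU word_evU.
by rewrite wtree_corolla.
Qed.

(** * The subalgebra generated by the letters *)

Lemma QDesc_val_morphism : nqsh_morphism (fun x : QDesc k => val x : QShd k).
Proof. by split. Qed.

Lemma QDesc_is_NQSh : is_NQSh (QDesc k).
Proof.
have nQ := QShd_is_NQSh k.
apply: (is_NQSh_injective _ _ _ QDesc_val_morphism val_inj nQ).
- by split=> x a y z; apply: val_inj;
  apply: (nprec_bilinear nQ).1 || apply: (nprec_bilinear nQ).2.
- by split=> x a y z; apply: val_inj;
  apply: (nsucc_bilinear nQ).1 || apply: (nsucc_bilinear nQ).2.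
- by split=> x a y z; apply: val_inj;
  apply: (nbul_bilinear nQ).1 || apply: (nbul_bilinear nQ).2.
Qed.

Lemma range_Omega_closed : nqsh_closed (range (@Omega k)).
Proof.
have mO := Omega_morphism k; split.
- by exists 0; rewrite // (linear_fun0 (@Omega_linear k)).
- by move=> a _ _ [x _ <-] [y _ <-]; exists (a *: x + y); rewrite // Omega_linear.
- by move=> _ _ [x _ <-] [y _ <-]; exists (x ≺ y)%nqsh; rewrite // (nmor_prec mO).
- by move=> _ _ [x _ <-] [y _ <-]; exists (x ≻ y)%nqsh; rewrite // (nmor_succ mO).
- by move=> _ _ [x _ <-] [y _ <-]; exists (x • y)%nqsh; rewrite // (nmor_bul mO).
Qed.

(** Freeness gives a morphism into [QDesc] that is already known on generators. Followed by the
    inclusion it is [Omega], hence it is injective; it is onto because the range of [Omega] is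
    closed and contains the generators. *)
Lemma Omega_corestriction : exists phi : treeNQSh k -> QDesc k,
  [/\ nqsh_morphism phi, bijective phi & phi \o @tree_gen k = @QDesc_gen k].
Proof.
have [phi [[mphi phiE] _]] := treeNQSh_free.2 _ QDesc_is_NQSh (@QDesc_gen k).
have phiO x : val (phi x) = Omega x.
  (* Only uniqueness is used here: the inclusion after [phi] and [Omega] are morphisms that agree on
     the generators. *)
  have [om [_ U]] := treeNQSh_free.2 _ (QShd_is_NQSh k) (@word_gen k).
  have h1 : (fun x => val (phi x) : QShd k) = @Omega k.
    rewrite -(U (@Omega k)); last first.
      by split; [exact: Omega_morphism|apply: funext => d; exact: Omega_tree_gen].
    rewrite -(U (fun x => val (phi x))) //; split.
      exact: (nqsh_morphism_comp QDesc_val_morphism mphi).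
    by apply: funext => d; have /(congr1 (fun f => val (f d))) := phiE.
  by rewrite -h1.
have surj (b : QDesc k) : exists x, phi x = b.
  (* An element of [QDesc] lies in every closed set containing the generators; the set chosen is the
     range of [Omega]. *)
  have /asboolP h := generatedP b.
  have [|x _ xb] := h (range (@Omega k)); last by exists x; apply: val_inj; rewrite phiO.
  split; first exact: range_Omega_closed.
  by move=> _ [d _ <-]; exists (tree_gen k d); rewrite // Omega_tree_gen.
exists phi; split=> //; exists (fun b => sval (cid (surj b))) => [x|b].
  by apply: (@Omega_inj k); rewrite -!phiO (svalP (cid (surj (phi x)))).
exact: (svalP (cid (surj b))).
Qed.

End Freeness.

Theorem theorem46 (k : fieldType) :
  (free_NQSh_on (@tree_gen k) /\ is_NQSh (QShd k)) /\
  (nqsh_morphism (@Omega k) /\ injective (@Omega k)) /\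
  (free_NQSh_on (@QDesc_gen k) /\ nqsh_isomorphic (QDesc k) (treeNQSh k)).
Proof.
have [phi [mphi phib phiE]] := Omega_corestriction k.
split; first by split; [exact: treeNQSh_free|exact: QShd_is_NQSh].
split; first by split; [exact: Omega_morphism|exact: Omega_inj].
split.
  by rewrite -phiE; apply: free_NQSh_on_iso => //;
    [exact: treeNQSh_free|exact: QDesc_is_NQSh].
by case: phib => g fg gf; exists g; split; [exact: nqsh_morphism_inv mphi fg gf|exists phi].
Qed.
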